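(* Let $2\le s\le r$ be fixed integers with $r$ sufficiently large in terms of $s$. If $0<p<1$ is fixed and $\Gamma=G(n,p)$, then with high probability (i.e. with probability tending to $1$ as $n\to\infty$) we have $\mathrm{ex}(\Gamma,\mathcal{P}_{K_{s,r}})=\Theta\big(n^{2-1/s}(\log n)^{1/s}\big)$.
   Context: $G(n,p)$ is the Erdős–Rényi random graph. For a graph $H$, $\mathcal{P}_H$ is the property of not containing $H$ as an induced subgraph, and $\mathrm{ex}(\Gamma,\mathcal{P})$ is the maximum number of edges of a subgraph $G\subseteq\Gamma$ that belongs to $\mathcal{P}$. The implicit constants in $\Theta$ may depend on $s,r,p$. *)

(* Defs.v *)
From mathcomp Require Import all_boot all_order all_algebra.
From mathcomp Require Import all_classical all_reals all_analysis.
Set Implicit Arguments. Unset Strict Implicit. Unset Printing Implicit Defensive.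
Import Order.TTheory GRing.Theory Num.Theory.
Local Open Scope ring_scope.

(* A (simple) graph on vertex set 'I_n is a set of 2-element subsets of 'I_n. *)
Definition pairs (n : nat) : {set {set 'I_n}} := [set e : {set 'I_n} | #|e| == 2%N].

Definition has_induced_Ksr (n s r : nat) (G : {set {set 'I_n}}) : bool :=
  [exists A : {set 'I_n}, exists B : {set 'I_n},
    [&& #|A| == s, #|B| == r, [disjoint A & B],
        [forall a in A, forall b in B, [set a; b] \in G],
        [forall a in A, forall a' in A, (a != a') ==> ([set a; a'] \notin G)] &
        [forall b in B, forall b' in B, (b != b') ==> ([set b; b'] \notin G)]]].

Definition ex_ind_Ksr (n s r : nat) (Gam : {set {set 'I_n}}) : nat :=
  \max_(G : {set {set 'I_n}} | (G \subset Gam) && ~~ has_induced_Ksr s r G) #|G|.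

Definition Gnp_prob (R : realType) (n : nat) (p : R)
    (E : {set {set 'I_n}} -> bool) : R :=
  \sum_(G : {set {set 'I_n}} | (G \subset pairs n) && E G)
     p ^+ #|G| * (1 - p) ^+ (#|pairs n| - #|G|).

(* Main.v *)
(* With high probability every set of at least [K log n] vertices spans a positive
   proportion of edges and of non-edges of [Gam] (union bound); the rest is
   deterministic.

   Upper bound: in such a set a positive proportion of the [t]-tuples are
   independent.  Hence a vertex of large degree [d] in [G] has about [d^s]
   independent [s]-tuples among its neighbours, while each independent [s]-tuple
   has only [O(log n)] common neighbours: otherwise these contain an independent
   [r]-set, giving an induced [K_{s,r}].  Double count (Kovari-Sos-Turan).

   Lower bound: greedily cut half of the vertices into cliques of [Gam] of size
   [L ~ log n], index the [M] cliques by [GF(q^s)], and keep the edges of [Gam]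
   inside the cliques and between the cliques [x], [y] with [N(x + y) = c], for
   the most popular value [c] of the norm.  Independent sets meet each clique at
   most once, so an induced [K_{s,r}] gives [s] distinct points [a_i] and many
   solutions [x] of [N(x + a_i) = c].  With [x_j = x^(q^j)] this is the system
   [prod_j (x_j - a_ij) = c], which has no solutions at infinity, so every
   monomial reduces to one of bounded degree and the number of solutions is
   bounded in terms of [s] (Kollar-Ronyai-Szabo). *)
Require Import Defs.
From mathcomp Require Import all_boot all_order all_algebra.
From mathcomp Require Import all_classical all_reals all_analysis.
From mathcomp Require Import all_field zify ring lra.
Import Order.TTheory GRing.Theory Num.Theory.
(* The classical library shadows lemmas on finite sets. *)
Import fintype boot.finset.
Set Implicit Arguments. Unset Strict Implicit. Unset Printing Implicit Defensive.

(** * Counting tuples in dense relations *)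

Section PairwiseCount.
Variables (V : finType) (e : rel V).

(** Counts the sequences of length [t] in [W] in which each entry is [e]-related to all later ones.
    Recursing into a neighbourhood lets the density hypothesis be reapplied there. *)
Fixpoint npairwise (t : nat) (W : {set V}) : nat :=
  if t is t'.+1 then \sum_(v in W) npairwise t' (W :&: [set u | e v u]) else 1.

Lemma npairwise_gt0 t (W : {set V}) : 0 < npairwise t W ->
  exists a : seq V, [/\ size a = t, {subset a <= W} & pairwise e a].
Proof.
elim: t W => [|t ih] W /=; first by exists [::].
rewrite lt0n sum_nat_eq0 negb_forall_in => /exists_inP[v vW].
rewrite -lt0n => /ih[a [sa aW pa]]; exists (v :: a); split => /=.
- by rewrite sa.
- move=> u; rewrite inE => /orP[/eqP->//|/aW].
  by rewrite inE => /andP[].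
- rewrite pa andbT; apply/allP => u /aW; by rewrite !inE => /andP[].
Qed.

Variables m d : nat.
Hypothesis dense : forall W : {set V}, m <= #|W| ->
  2 * #|W| ^ 2 <= d * \sum_(v in W) #|W :&: [set u | e v u]|.

(** At least [#|W| / d] vertices have at least [#|W| / d] neighbours inside [W]; recurse into those
    neighbourhoods. Each level divides the size by at most [d], so the set never drops below [m],
    and the total loss satisfies [t ^ 2 + t + 1 <= t.+1 ^ 2]. *)
Lemma npairwise_lb t (W : {set V}) : 0 < d -> m * d ^ t <= #|W| ->
  #|W| ^ t <= d ^ (t ^ 2) * npairwise t W.
Proof.
move=> d0; elim: t W => [|t ih] W //= hW.
have [W0|Wpos] := posnP #|W|; first by rewrite W0 exp0n.
pose nb v := W :&: [set u | e v u].
pose good := [set v in W | #|W| <= d * #|nb v|].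
have mW : m <= #|W| by apply: leq_trans hW; rewrite leq_pmulr // expn_gt0 d0.
(* The factor 2 in the density is spent here: the vertices that are not good account for at most one
   of the two copies of [#|W| ^ 2]. *)
have hgood : #|W| <= d * #|good|.
  have := dense mW; rewrite (bigID (fun v => #|W| <= d * #|nb v|)) /= mulnDr.
  set S1 := \sum_(v in W | _) _; set S2 := \sum_(v in W | _) _.
  have h1 : S1 <= #|good| * #|W|.
    rewrite -sum_nat_const.
    rewrite [leqRHS](eq_bigl (fun v => (v \in W) && (#|W| <= d * #|nb v|))).
      by apply: leq_sum => v _; rewrite subset_leq_card // subsetIl.
    by move=> v; rewrite inE.
  have h2 : d * S2 <= #|W| * #|W|.
    rewrite big_distrr /= -[X in _ <= X * _]sum1_card big_distrl /=.
    rewrite [leqRHS](bigID (fun v => #|W| <= d * #|nb v|)) /=.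
    apply: leq_trans (leq_addl _ _); apply: leq_sum => v /andP[_].
    by rewrite -ltnNge mul1n => /ltnW.
  move=> h3; rewrite -(leq_pmul2r Wpos).
  have h4 : d * S1 <= d * #|good| * #|W| by rewrite -mulnA leq_mul2l h1 orbT.
  by move: h3; rewrite -mulnn; lia.
have h5 v : v \in good -> #|W| ^ t <= d ^ (t ^ 2 + t) * npairwise t (nb v).
  rewrite inE => /andP[vW hv].
  have hm : m * d ^ t <= #|nb v|.
    rewrite -(leq_pmul2l d0); apply: leq_trans hv.
    by rewrite mulnCA -expnS.
  have := ih _ hm; rewrite -(leq_pmul2l (_ : 0 < d ^ t)) ?expn_gt0 ?d0 //.
  rewrite -expnMn mulnA -expnD addnC => h6; apply: leq_trans h6.
  by case: (posnP t) => [->|t0]; rewrite ?expn0 ?leq_exp2r.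
rewrite expnS; apply: (@leq_trans (d * \sum_(v in good) #|W| ^ t)).
  by rewrite sum_nat_const mulnA leq_mul2r hgood orbT.
apply: (@leq_trans (d * (d ^ (t ^ 2 + t) * \sum_(v in good) npairwise t (nb v)))).
  by rewrite leq_mul2l big_distrr /= leq_sum ?orbT.
rewrite mulnA -expnS; apply: leq_mul.
  by rewrite leq_pexp2l //; lia.
rewrite [leqRHS](bigID (fun v => #|W| <= d * #|nb v|)) /=.
rewrite [leqLHS](eq_bigl (fun v => (v \in W) && (#|W| <= d * #|nb v|))).
  exact: leq_addr.
by move=> v; rewrite inE.
Qed.

(* Counts the pairs of a vertex and a tuple of its neighbours. *)
Lemma common_neighbours_large (g : rel V) t D (U W : {set V}) :
  #|V| ^ t * D < \sum_(v in U) npairwise t (W :&: [set u | g v u]) ->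
  exists a : seq V, [/\ size a = t, {subset a <= W}, pairwise e a &
    D < #|[set v in U | all (g v) a]|].
Proof.
elim: t U W => [|t ih] U W /=.
  rewrite sum1_card mul1n => h; exists [::]; split => //.
  by apply: leq_trans h _; rewrite subset_leq_card //; apply/subsetP => v; rewrite inE andbT.
move=> h.
(* Averaging over the first entry [w] of the tuple; each entry costs a factor [#|V|]. *)
have [w wW hw] : exists2 w, w \in W &
  #|V| ^ t * D < \sum_(v in U :&: [set v | g v w])
     npairwise t ((W :&: [set u | e w u]) :&: [set u | g v u]).
  apply/exists_inP; apply: contraTT h; rewrite negb_exists_in => /forall_inP h.
  rewrite -leqNgt (exchange_big_dep (mem W)) /=; last first.
    by move=> v w _; rewrite inE => /andP[].
  apply: (@leq_trans (\sum_(w in W) #|V| ^ t * D)).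
    apply: leq_sum => w wW; have := h w wW; rewrite -leqNgt; apply: leq_trans.
    rewrite [leqLHS](eq_bigl (fun v => v \in U :&: [set v | g v w])); last first.
      by move=> v; rewrite !inE wW.
    by apply: leq_sum => v _; rewrite setIAC.
  by rewrite sum_nat_const expnS -mulnA leq_mul2r max_card orbT.
have [a [sa aW pa Da]] := ih _ _ hw; exists (w :: a); split => /=.
- by rewrite sa.
- move=> u; rewrite inE => /orP[/eqP->//|/aW].
  by rewrite inE => /andP[].
- by rewrite pa andbT; apply/allP => u /aW; rewrite !inE => /andP[].
- apply: leq_trans Da _; apply: subset_leq_card; apply/subsetP => v.
  by rewrite !inE -andbA.
Qed.

End PairwiseCount.

Lemma pairwise_uniq_irr (V : eqType) (e : rel V) a : irreflexive e ->
  pairwise e a -> uniq a.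
Proof.
move=> ie; rewrite uniq_pairwise; apply: sub_pairwise => u v.
by apply: contraTneq => ->; rewrite ie.
Qed.

Lemma pairwise_in (V : eqType) (e : rel V) a u v : symmetric e ->
  pairwise e a -> u \in a -> v \in a -> u != v -> e u v.
Proof.
move=> es; elim: a => // w a ih /= /andP[/allP wa pa].
rewrite !inE => /orP[/eqP->|ua] /orP[/eqP->|va]; rewrite ?eqxx //.
- by move=> _; apply: wa.
- by move=> _; rewrite es; apply: wa.
- exact: ih.
Qed.

(** * Deterministic bounds in a fixed host graph *)

Section Graphs.
Variable n : nat.
Implicit Types Gam G : {set {set 'I_n}}.

Definition adj G : rel 'I_n := fun u v => [set u; v] \in G.
(** Distinctness is built in, so that a pairwise non-adjacent sequence has no repeated entry. *)
Definition nonadj G : rel 'I_n := fun u v => (u != v) && ([set u; v] \notin G).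
Definition nbrs G v : {set 'I_n} := [set u | adj G v u].

(** The factor 2 is slack: [#|W| ^ 2] survives after discarding low-degree vertices, or pairs inside
    a common clique. *)
Definition dense_rel (m d : nat) (e : rel 'I_n) := forall W : {set 'I_n},
  m <= #|W| -> 2 * #|W| ^ 2 <= d * \sum_(v in W) #|W :&: [set u | e v u]|.

Lemma adj_sym G : symmetric (adj G).
Proof. by move=> u v; rewrite /adj setUC. Qed.

Lemma nonadj_sym G : symmetric (nonadj G).
Proof. by move=> u v; rewrite /nonadj setUC eq_sym. Qed.

Lemma adj_irr G : G \subset pairs n -> irreflexive (adj G).
Proof.
move=> /subsetP h u; by apply/negP => /h; rewrite inE setUid cards1.
Qed.

Lemma adj_neq G u v : G \subset pairs n -> adj G u v -> u != v.
Proof. by move=> h; apply: contraTneq => ->; rewrite adj_irr. Qed.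

(** A vertex of large degree sees at least [deg ^ s / d ^ (s ^ 2)] independent [s]-tuples. If the
    bound failed, one such tuple would have more than [m * d ^ r] common neighbours, enough to
    contain an independent [r]-tuple. *)
Lemma degree_power_sum Gam G s r m d : Gam \subset pairs n -> G \subset Gam ->
  0 < m -> 0 < d -> dense_rel m d (nonadj Gam) -> ~~ has_induced_Ksr s r G ->
  \sum_(v | m * d ^ s <= #|nbrs G v|) #|nbrs G v| ^ s
    <= d ^ (s ^ 2) * (n ^ s * (m * d ^ r)).
Proof.
move=> GamP GGam m0 d0 dns; apply: contraR; rewrite -ltnNge => h.
have {}h : n ^ s * (m * d ^ r) <
    \sum_(v in [set: 'I_n]) npairwise (nonadj Gam) s ([set: 'I_n] :&: nbrs G v).
  rewrite -(ltn_pmul2l (_ : 0 < d ^ (s ^ 2))) ?expn_gt0 ?d0 //.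
  apply: leq_trans h _.
  rewrite big_distrr /= [leqRHS](bigID (fun v => m * d ^ s <= #|nbrs G v|)) /=.
  apply: leq_trans (leq_addr _ _).
  rewrite [leqRHS](eq_bigl (fun v => m * d ^ s <= #|nbrs G v|)); last by move=> v; rewrite inE.
  by apply: leq_sum => v hv; rewrite setTI (npairwise_lb dns).
rewrite -[X in X ^ s * _ < _]card_ord in h.
have [a [sa _ pa]] := common_neighbours_large h.
set U := [set v in _ | _] => hU.
have U0 : 0 < #|U| by apply: leq_ltn_trans hU.
have /npairwise_gt0[b [sb bU pb]] : 0 < npairwise (nonadj Gam) r U.
  have := npairwise_lb dns d0 (ltnW hU).
  have : 0 < #|U| ^ r by rewrite expn_gt0 U0.
  by move=> x0 hx; have := leq_trans x0 hx; rewrite muln_gt0 => /andP[].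
have ie : irreflexive (nonadj Gam) by move=> u; rewrite /nonadj eqxx.
have ab u v : u \in a -> v \in b -> adj G u v.
  by move=> ua /bU; rewrite !inE => /allP/(_ _ ua); rewrite adj_sym.
(* Independence is found in [Gam], where density is known, and passes to the subgraph [G]. *)
have indep (c : seq 'I_n) : pairwise (nonadj Gam) c -> forall u v,
    u \in c -> v \in c -> u != v -> [set u; v] \notin G.
  move=> pc u v uc vc uv; have := pairwise_in (nonadj_sym Gam) pc uc vc uv.
  by rewrite /nonadj uv /=; apply: contra => /(subsetP GGam).
apply/existsP; exists [set x in a]; apply/existsP; exists [set x in b].
apply/and5P; split.
- by rewrite cardsE (card_uniqP _) ?sa // (pairwise_uniq_irr ie).
- by rewrite cardsE (card_uniqP _) ?sb // (pairwise_uniq_irr ie).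
- rewrite disjoint_subset; apply/subsetP => u; rewrite !inE => ua.
  apply/negP => ub; have := ab _ _ ua ub.
  by rewrite adj_irr // (subset_trans GGam).
- apply/forall_inP => u; rewrite inE => ua; apply/forall_inP => v; rewrite inE => vb.
  exact: ab.
- apply/andP; split; apply/forall_inP => u; rewrite inE => ua; apply/forall_inP => v;
    rewrite inE => va; apply/implyP; exact: indep ua va.
Qed.

Lemma card_le_degree_sum G : G \subset pairs n ->
  #|G| <= \sum_v #|nbrs G v|.
Proof.
move=> GP; pose P := [set p : 'I_n * 'I_n | adj G p.1 p.2].
have -> : \sum_v #|nbrs G v| = #|P|.
  rewrite -sum1_card (eq_bigl (fun p => adj G p.1 p.2)); last by move=> p; rewrite inE.
  rewrite -(pair_big_dep xpredT (adj G) (fun _ _ => 1)) /=.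
  by apply: eq_bigr => v _; rewrite -sum1_card; apply: eq_bigl => u; rewrite inE.
apply: leq_trans (leq_imset_card (fun p : 'I_n * 'I_n => [set p.1; p.2]) P).
apply: subset_leq_card; apply/subsetP => E EG.
have := subsetP GP E EG; rewrite inE => /cards2P[u [v [uv Euv]]].
by apply/imsetP; exists (u, v); rewrite ?inE /adj /= -?Euv.
Qed.

(** All ordered pairs giving the edge [E] lie in [E] times [E], which has 4 elements. *)
Lemma card_ordered_le G (P : {set 'I_n * 'I_n}) : G \subset pairs n ->
  (forall p, p \in P -> [set p.1; p.2] \in G) -> #|P| <= 4 * #|G|.
Proof.
move=> GP PG.
apply: (@leq_trans (\sum_(E in G) #|[set p in P | [set p.1; p.2] == E]|)).
  rewrite -sum1_card (partition_big (fun p : 'I_n * 'I_n => [set p.1; p.2]) (mem G)) //=.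
  apply: leq_sum => E _; rewrite -sum1_card; apply: eq_leq; apply: eq_bigl => p.
  by rewrite inE.
rewrite mulnC -sum_nat_const; apply: leq_sum => E EG.
have := subsetP GP E EG; rewrite inE => /eqP E2.
apply: (@leq_trans #|setX E E|); last by rewrite cardsX E2.
apply: subset_leq_card; apply/subsetP => -[u v]; rewrite !inE => /andP[_ /eqP <-].
by rewrite !inE !eqxx orbT.
Qed.

(** * Blowing up a coloured index set along disjoint cliques *)

(** Greedy choice: before the last step at least half of the vertices are uncovered, and
    [npairwise_lb] finds a further clique among them. [bl u] is the index of the clique containing
    [u], or [None]. *)
Lemma disjoint_cliques Gam m d L M : Gam \subset pairs n ->
  0 < m -> 0 < d -> dense_rel m d (adj Gam) ->
  2 * (M * L) <= n -> 2 * (m * d ^ L) <= n ->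
  exists bl : 'I_n -> option 'I_M,
    (forall i, #|[set u | bl u == Some i]| = L) /\
    (forall u v i, u != v -> bl u = Some i -> bl v = Some i -> adj Gam u v).
Proof.
move=> GamP m0 d0 dns hM hL.
suff : forall k, k <= M -> exists bl : 'I_n -> option 'I_M,
    [/\ forall i : 'I_M, i < k -> #|[set u | bl u == Some i]| = L,
        forall u v i, u != v -> bl u = Some i -> bl v = Some i -> adj Gam u v,
        forall u i, bl u = Some i -> i < k &
        #|[set u | bl u != None]| = k * L].
  move=> /(_ M (leqnn M))[bl [h1 h2 _ _]]; exists bl; split => // i.
  by apply: h1; apply: ltn_ord.
elim=> [_|k ih kM].
  exists (fun=> None); split => //.
  by apply/eqP; rewrite cards_eq0; apply/eqP/setP => u; rewrite !inE.
have [bl [h1 h2 h3 h4]] := ih (ltnW kM).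
pose W := [set u | bl u == None].
have cW : #|W| + k * L = n.
  rewrite -h4 -[RHS]card_ord -(cardsC W); congr (_ + _).
  by apply: eq_card => u; rewrite !inE.
have hW : m * d ^ L <= #|W|.
  have : k * L <= M * L by rewrite leq_mul2r (ltnW kM) orbT.
  by move: cW hM hL; lia.
have W0 : 0 < #|W|.
  by apply: leq_trans hW; rewrite muln_gt0 m0 expn_gt0 d0.
have /npairwise_gt0[a [sa aW pa]] : 0 < npairwise (adj Gam) L W.
  have := npairwise_lb dns d0 hW.
  have : 0 < #|W| ^ L by rewrite expn_gt0 W0.
  by move=> x0 hx; have := leq_trans x0 hx; rewrite muln_gt0 => /andP[].
have ua := pairwise_uniq_irr (adj_irr GamP) pa.
have aN u : u \in a -> bl u = None by move=> /aW; rewrite inE => /eqP.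
pose ik := Ordinal kM.
exists (fun u => if u \in a then Some ik else bl u); split => [i|u v i uv|u i|].
- rewrite ltnS leq_eqVlt => /orP[/eqP ik_|ik_].
    have -> : i = ik by apply/val_inj.
    rewrite -sa -(card_uniqP ua); apply: eq_card => u; rewrite !inE.
    case ua': (u \in a); first by rewrite eqxx.
    by apply/negP => /eqP/h3; rewrite ltnn.
  rewrite -(h1 i ik_); apply: eq_card => u; rewrite !inE.
  case ua': (u \in a) => //; rewrite aN //; apply/eqP => -[e].
  by rewrite -e ltnn in ik_.
- case ua': (u \in a); case va': (v \in a).
  + by move=> _ _; apply: (pairwise_in (adj_sym Gam) pa).
  + by move=> [<-] /h3; rewrite ltnn.
  + by move=> /h3 + [e]; rewrite -e ltnn.
  + exact: h2.
- case: ifP => [_ [<-] //|_ /h3 h]; exact: ltnW.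
- have ca : #|[set u in a]| = L by rewrite cardsE (card_uniqP ua).
  rewrite mulSn -h4 -{1}ca -cardsUI [X in _ = (_ + #|pred_of_set X|)%N](_ : _ = set0).
    by rewrite cards0 addn0; apply: eq_card => u; rewrite !inE; case: ifP.
  by apply/setP => u; rewrite !inE; case ua': (u \in a) => //=; rewrite aN.
Qed.

(** Pairs inside a common clique number [M * L ^ 2], at most [(M * L) ^ 2 / d] because [d <= M]. The
    factor 2 of the density leaves as many pairs between distinct cliques, and one of the [q]
    colours takes its share of them. *)
Lemma blowup_size Gam m d L M q (chi : 'I_M -> 'I_M -> 'I_q)
    (bl : 'I_n -> option 'I_M) :
  Gam \subset pairs n -> dense_rel m d (adj Gam) ->
  (forall i, #|[set u | bl u == Some i]| = L) ->
  0 < q -> d <= M -> m <= M * L ->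
  exists c, (M * L) ^ 2 <= d * q *
    #|[set p : 'I_n * 'I_n | adj Gam p.1 p.2 &
        if bl p.1 is Some i then if bl p.2 is Some j then
          (i != j) && (chi i j == c) else false else false]|.
Proof.
move=> GamP dns hL q0 dM mM.
pose U := [set u | bl u != None].
have cU : #|U| = M * L.
  rewrite -[M in RHS]card_ord -sum_nat_const -sum1_card.
  rewrite (partition_big bl (fun o => o != None)) /=; last by move=> u; rewrite inE.
  rewrite (reindex_omap Some id) /=; last by case.
  rewrite [LHS](eq_bigl xpredT); last by move=> i; rewrite eqxx.
  apply: eq_bigr => i _; rewrite -(hL i) -sum1_card; apply: eq_bigl => u.
  by rewrite !inE; case: (bl u) => //= j; rewrite andbC.
have := dns U; rewrite cU => /(_ mM) hU.
pose X := [set p : 'I_n * 'I_n | adj Gam p.1 p.2 &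
        if bl p.1 is Some i then if bl p.2 is Some j then i != j else false else false].
have h1 : \sum_(v in U) #|U :&: [set u | adj Gam v u]| <= M * L * L + #|X|.
  pose X2 := [set p : 'I_n * 'I_n | [&& p.1 \in U & bl p.1 == bl p.2]].
  have -> : M * L * L = #|X2|.
    rewrite -cU -sum_nat_const -sum1_card.
    rewrite (eq_bigl (fun p => (p.1 \in U) && (bl p.1 == bl p.2))); last by move=> p; rewrite inE.
    rewrite -(pair_big_dep (mem U) (fun u v => bl u == bl v) (fun _ _ => 1)) /=.
    apply: eq_bigr => u; rewrite inE; case: (bl u) => [i|] // _.
    by rewrite -(hL i) -sum1_card; apply: eq_bigl => v; rewrite inE eq_sym.
  rewrite -cardsUI; apply: leq_trans (leq_addr _ _).
  have -> : \sum_(v in U) #|U :&: [set u | adj Gam v u]| =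
      #|[set p : 'I_n * 'I_n | (p.1 \in U) && ((p.2 \in U) && adj Gam p.1 p.2)]|.
    rewrite -[RHS]sum1_card.
    rewrite [RHS](eq_bigl (fun p => (p.1 \in U) && ((p.2 \in U) && adj Gam p.1 p.2))); last first.
      by move=> p; rewrite inE.
    rewrite -(pair_big_dep (mem U) (fun u v => (v \in U) && adj Gam u v) (fun _ _ => 1)) /=.
    by apply: eq_bigr => u _; rewrite -sum1_card; apply: eq_bigl => v; rewrite !inE.
  apply: subset_leq_card; apply/subsetP => -[u v]; rewrite !inE /=.
  case: (bl u) => [i|] //=; case: (bl v) => [j|] //= ->.
  by rewrite -[Some i == Some j]/(i == j); case: (i == j).
have h2 : (M * L) ^ 2 <= d * #|X|.
  have : d * (M * L * L) <= (M * L) ^ 2.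
    have -> : (M * L) ^ 2 = M * (M * L * L).
      by rewrite -mulnn [LHS]mulnA [RHS]mulnA [M * (M * L)]mulnC.
    by rewrite leq_mul2r dM orbT.
  have : d * \sum_(v in U) #|U :&: [set u | adj Gam v u]| <= d * (M * L * L) + d * #|X|.
    by rewrite -mulnDr leq_mul2l h1 orbT.
  move=> /(leq_trans hU) hS hd; rewrite -(leq_add2l (d * (M * L * L))).
  by apply: leq_trans hS; rewrite mul2n -addnn leq_add2r.
pose Xc c := [set p : 'I_n * 'I_n | adj Gam p.1 p.2 &
        if bl p.1 is Some i then if bl p.2 is Some j then
          (i != j) && (chi i j == c) else false else false].
suff /existsP[c hc] : [exists c, (M * L) ^ 2 <= d * q * #|Xc c|] by exists c.
apply: contraT; rewrite negb_exists => /forallP hc.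
have h3 : #|X| <= \sum_c #|Xc c|.
  (* The default colour [Ordinal q0] is never taken on [X], whose pairs have both ends covered. *)
  pose col (p : 'I_n * 'I_n) : 'I_q :=
    if bl p.1 is Some i then if bl p.2 is Some j then chi i j
      else Ordinal q0 else Ordinal q0.
  rewrite -sum1_card (partition_big col xpredT) //=; apply: leq_sum => c _.
  rewrite -sum1_card; apply: eq_leq; apply: eq_bigl => p; rewrite !inE /col.
  by case: (bl p.1) => [i|]; case: (bl p.2) => [j|]; rewrite ?andbF ?andbA.
have : q * (M * L) ^ 2 <= \sum_c d * q * #|Xc c|.
  by rewrite -big_distrr /= mulnAC mulnC leq_mul2r (leq_trans h2) ?orbT // leq_mul2l h3 orbT.
have : \sum_c d * q * #|Xc c| <= q * ((M * L) ^ 2).-1.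
  rewrite -[q in q * _.-1]card_ord -sum_nat_const; apply: leq_sum => c _.
  by have := hc c; rewrite -ltnNge; case: (_ ^ 2).
have : 0 < (M * L) ^ 2.
  by have := hc (Ordinal q0); rewrite -ltnNge; apply: leq_ltn_trans.
case: (_ ^ 2) => // N _ /= h4 h5; have := leq_trans h5 h4.
by rewrite leq_pmul2l // ltnn.
Qed.

(** Clique edges are kept in [G], so each side of an induced copy maps injectively to indices. At
    most [s] indices of [B] occur in [A]; every other one has colour [c] to all of [A], so there are
    at most [b] of them, against [b + s < r]. *)
Lemma blowup_free Gam M q s r b (chi : 'I_M -> 'I_M -> 'I_q)
    (bl : 'I_n -> option 'I_M) (c : 'I_q) :
  Gam \subset pairs n -> 0 < s -> b + s < r ->
  (forall x y, chi x y = chi y x) ->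
  (forall A : {set 'I_M}, #|A| = s -> #|[set x | [forall a in A, chi a x == c]]| <= b) ->
  (forall u v i, u != v -> bl u = Some i -> bl v = Some i -> adj Gam u v) ->
  exists2 G : {set {set 'I_n}}, (G \subset Gam) && ~~ has_induced_Ksr s r G &
  forall u v, adj Gam u v ->
     (if bl u is Some i then if bl v is Some j then
          (i != j) && (chi i j == c) else false else false) -> adj G u v.
Proof.
move=> GamP s0 hr chiC hb hcl.
pose conn u v := if bl u is Some i then if bl v is Some j then
          (i == j) || (chi i j == c) else false else false.
have connC u v : conn u v = conn v u.
  by rewrite /conn; case: (bl u) => [i|]; case: (bl v) => [j|] //; rewrite eq_sym chiC.
(* Edges are unordered, so the condition ranges over both orders of the ends; [connC] makes them
   equivalent. *)
pose G := [set E in Gam | [forall u in E, forall v in E, (u != v) ==> conn u v]].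
have GGam : G \subset Gam by apply/subsetP => E; rewrite inE => /andP[].
have adjG u v : adj G u v = adj Gam u v && conn u v.
  rewrite /adj inE; case E: ([set u; v] \in Gam) => //=.
  have uv : u != v by apply: (adj_neq GamP).
  apply/idP/idP => [/forall_inP/(_ u)|h].
    rewrite !inE eqxx => /(_ isT)/forall_inP/(_ v).
    by rewrite !inE eqxx orbT uv => /(_ isT).
  apply/forall_inP => x; rewrite !inE => /orP[]/eqP->; apply/forall_inP => y;
    rewrite !inE => /orP[]/eqP->; rewrite ?eqxx //; apply/implyP => _ //.
  by rewrite connC.
exists G; last first.
  move=> u v uv h; rewrite adjG uv /conn; move: h.
  by case: (bl u) => // i; case: (bl v) => // j /andP[_ ->]; rewrite orbT.
rewrite GGam /=; apply/negP => /existsP[A /existsP[B /and5P[/eqP cA /eqP cB _ hAB /andP[hA hB]]]].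
have AB u v : u \in A -> v \in B -> conn u v.
  move=> uA vB; have := forall_inP (forall_inP hAB u uA) v vB.
  by move: (adjG u v); rewrite /adj => -> /andP[].
have r0 : 0 < r by apply: leq_ltn_trans hr.
have [a0 a0A] : exists a, a \in A by apply/set0Pn; rewrite -card_gt0 cA.
have [b0 b0B] : exists b, b \in B by apply/set0Pn; rewrite -card_gt0 cB.
have [i0 _] : exists i, bl a0 = Some i.
  by have := AB _ _ a0A b0B; rewrite /conn; case: (bl a0) => // i; exists i.
(* The default [i0] is never taken on [A] or [B]: a vertex there is connected to [b0] or [a0], hence
   lies in a clique. *)
pose f u := odflt i0 (bl u).
have fA u : u \in A -> bl u = Some (f u).
  by move=> uA; have := AB _ _ uA b0B; rewrite /conn /f; case: (bl u).
have fB u : u \in B -> bl u = Some (f u).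
  by move=> uB; have := AB _ _ a0A uB; rewrite connC /conn /f; case: (bl u).
have inj (C : {set 'I_n}) : (forall u, u \in C -> bl u = Some (f u)) ->
    [forall a in C, forall a' in C, (a != a') ==> ([set a; a'] \notin G)] ->
    #|f @: C| = #|C|.
  move=> fC hC; apply: card_in_imset => u v uC vC e; apply/eqP.
  apply: contraT => uv; have := forall_inP (forall_inP hC u uC) v vC.
  rewrite uv /= -/(adj G u v) adjG (hcl u v (f u)) // ?fC // -?e //.
  by rewrite /conn !fC // e eqxx.
have cA' := inj A fA hA; have cB' := inj B fB hB; rewrite cA in cA'; rewrite cB in cB'.
have := hb _ cA'; rewrite leqNgt => /negP; apply.
apply: (@leq_trans #|(f @: B) :\: (f @: A)|).
  have := cardsID (f @: A) (f @: B); rewrite cB'.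
  have : #|f @: B :&: f @: A| <= s by rewrite -cA' subset_leq_card // subsetIr.
  by move: hr; lia.
apply: subset_leq_card; apply/subsetP => x; rewrite !inE => /andP[xA /imsetP[v vB ex]].
apply/forall_inP => _ /imsetP[u uA ->].
have := AB u v uA vB; rewrite /conn fA // fB // -ex => /orP[/eqP e|//].
by move: xA; rewrite -e imset_f.
Qed.

Lemma ex_ind_lower Gam m d L M q s r b (chi : 'I_M -> 'I_M -> 'I_q) :
  Gam \subset pairs n -> 0 < m -> 0 < d -> dense_rel m d (adj Gam) ->
  2 * (M * L) <= n -> 2 * (m * d ^ L) <= n ->
  0 < q -> d <= M -> m <= M * L -> 0 < s -> b + s < r ->
  (forall x y, chi x y = chi y x) ->
  (forall c (A : {set 'I_M}), #|A| = s -> #|[set x | [forall a in A, chi a x == c]]| <= b) ->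
  (M * L) ^ 2 <= 4 * d * q * ex_ind_Ksr s r Gam.
Proof.
move=> GamP m0 d0 dns hM hL q0 dM mM s0 hr chiC hb.
have [bl [hbl hcl]] := disjoint_cliques GamP m0 d0 dns hM hL.
have [c hc] := blowup_size chi GamP dns hbl q0 dM mM.
have [G hG adjG] := blowup_free GamP s0 hr chiC (hb c) hcl.
apply: leq_trans hc _.
have -> : 4 * d * q * ex_ind_Ksr s r Gam = d * q * (4 * ex_ind_Ksr s r Gam) by ring.
rewrite leq_mul2l; apply/orP; right.
have GP : G \subset pairs n by case/andP: hG => h _; apply: subset_trans GamP.
apply: (@leq_trans (4 * #|G|)).
  apply: card_ordered_le => // p; rewrite inE => /andP[h1 h2].
  exact: adjG h1 h2.
rewrite leq_mul2l /=; exact: (@leq_bigmax_cond _ _ (fun G : {set {set 'I_n}} => #|G|)).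
Qed.

End Graphs.

Local Open Scope ring_scope.

(** * The norm system *)

(** Lagrange interpolation of the constant 1: the difference of the two sides has degree below
    [#|A|] and vanishes at the [#|A|] nodes. *)
Lemma lagrange_partition_of_unity (F : fieldType) (I : finType) (A : {set I})
    (a : I -> F) : injective a -> A != set0 ->
  exists l : I -> F, forall y : F,
    \sum_(i in A) l i * \prod_(k in A :\ i) (y - a k) = 1.
Proof.
move=> aI A0; exists (fun i => (\prod_(k in A :\ i) (a i - a k))^-1) => y.
pose l i : F := (\prod_(k in A :\ i) (a i - a k))^-1.
rewrite (eq_bigr (fun i => l i * \prod_(k in A :\ i) (y - a k))) //.
pose P : {poly F} := \sum_(i in A) (l i)%:P * \prod_(k in A :\ i) ('X - (a k)%:P) - 1.
have hP z : P.[z] = \sum_(i in A) l i * \prod_(k in A :\ i) (z - a k) - 1.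
  rewrite /P hornerD hornerN hornerC horner_sum; congr (_ - _).
  apply: eq_bigr => i _; rewrite hornerM hornerC horner_prod; congr (_ * _).
  by apply: eq_bigr => k _; rewrite hornerXsubC.
have P0 : P = 0.
  apply: (@roots_geq_poly_eq0 _ P [seq a i | i <- enum A]).
  - apply/allP => _ /mapP[i iA ->]; rewrite mem_enum in iA.
    rewrite /root hP (bigD1 i) //= [X in _ + X - 1]big1 ?addr0; last first.
      move=> k /andP[kA ki].
      by rewrite (bigD1 i) /= ?subrr ?mul0r ?mulr0 // !inE eq_sym ki.
    rewrite mulVf ?subrr //; apply/prodf_neq0 => k.
    by rewrite !inE => /andP[ki _]; rewrite subr_eq0 (inj_eq aI) eq_sym.
  - by rewrite map_inj_uniq ?enum_uniq.
  - rewrite size_map -cardE; apply: leq_trans (size_polyD _ _) _.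
    rewrite geq_max size_polyN size_poly1 andbC lt0n cards_eq0 A0 /=.
    apply: leq_trans (size_sum _ _ _) _; apply/bigmax_leqP => i iA.
    apply: leq_trans (size_polyMleq _ _) _.
    rewrite -big_enum /= size_prod_XsubC -cardE addnS /=.
    have -> : #|A| = #|A :\ i|.+1 by rewrite (cardsD1 i A) iA.
    by rewrite -add1n leq_add2r size_polyC_leq1.
by apply/eqP; rewrite -subr_eq0 -hP P0 horner0.
Qed.

Section NormSystem.
Variables (F : fieldType) (T : Type) (s : nat) (x : 'I_s -> T -> F).

Definition monomial (al : 'I_s -> nat) (t : T) : F := \prod_j x j t ^+ al j.

(** Linear span of the monomials with exponents in [P], taken among functions on [T] rather than
    among polynomials, so that equations valid on [T] act as identities. *)
Inductive mspan (P : ('I_s -> nat) -> Prop) : (T -> F) -> Prop :=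
| mspan_mon al : P al -> mspan P (monomial al)
| mspan0 : mspan P (fun=> 0)
| mspanD g h : mspan P g -> mspan P h -> mspan P (fun t => g t + h t)
| mspanZ c g : mspan P g -> mspan P (fun t => c * g t)
| mspan_ext g h : mspan P g -> g =1 h -> mspan P h.

Lemma mspan_sub P Q g : (forall al, P al -> mspan Q (monomial al)) ->
  mspan P g -> mspan Q g.
Proof.
move=> PQ; elim=> [al /PQ//||? ? _ ? _ ?|? ? _ ?|? ? _ ? gh].
- exact: mspan0.
- exact: mspanD.
- exact: mspanZ.
- exact: mspan_ext gh.
Qed.

Lemma mspanW P Q g : (forall al, P al -> Q al) -> mspan P g -> mspan Q g.
Proof. by move=> PQ; apply: mspan_sub => al /PQ; apply: mspan_mon. Qed.

Lemma monomialD al be t :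
  monomial (fun j => al j + be j)%N t = monomial al t * monomial be t.
Proof. by rewrite -big_split /=; apply: eq_bigr => j _; rewrite exprD. Qed.

Lemma mspanM P Q R g h :
  (forall al be, P al -> Q be -> R (fun j => al j + be j)%N) ->
  mspan P g -> mspan Q h -> mspan R (fun t => g t * h t).
Proof.
move=> PQR Pg Qh; elim: Pg => [al Pal||g1 g2 _ h1 _ h2|c g1 _ h1|g1 g2 _ h1 e].
- elim: Qh => [be Qbe||k1 k2 _ h1 _ h2|c k1 _ h1|k1 k2 _ h1 e].
  + by apply: mspan_ext (monomialD al be); apply/mspan_mon/PQR.
  + by apply: mspan_ext (mspan0 _) _ => t; rewrite mulr0.
  + by apply: mspan_ext (mspanD h1 h2) _ => t; rewrite mulrDr.
  + by apply: mspan_ext (mspanZ c h1) _ => t; rewrite mulrCA.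
  + by apply: mspan_ext h1 _ => t; rewrite e.
- by apply: mspan_ext (mspan0 _) _ => t; rewrite mul0r.
- by apply: mspan_ext (mspanD h1 h2) _ => t; rewrite mulrDl.
- by apply: mspan_ext (mspanZ c h1) _ => t; rewrite mulrA.
- by apply: mspan_ext h1 _ => t; rewrite e.
Qed.

Lemma mspan_sum P (I : Type) (r : seq I) (C : pred I) (g : I -> T -> F) :
  (forall i, C i -> mspan P (g i)) -> mspan P (fun t => \sum_(i <- r | C i) g i t).
Proof.
move=> Pg; elim: r => [|i r ih].
  by apply: mspan_ext (mspan0 _) _ => t; rewrite big_nil.
case Ci : (C i); last first.
  by apply: mspan_ext ih _ => t; rewrite big_cons Ci.
by apply: mspan_ext (mspanD (Pg _ Ci) ih) _ => t; rewrite big_cons Ci.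
Qed.

Lemma mspan_const (P : ('I_s -> nat) -> Prop) c :
  P (fun=> 0%N) -> mspan P (fun=> c).
Proof.
move=> P0; apply: mspan_ext (mspanZ c (mspan_mon P0)) _ => t.
by rewrite /monomial big1 ?mulr1.
Qed.

Lemma mspan_var (P : ('I_s -> nat) -> Prop) j :
  P (fun k => k == j)%N -> mspan P (x j).
Proof.
move=> Pj; apply: mspan_ext (mspan_mon Pj) _ => t.
rewrite /monomial (bigD1 j) //= eqxx expr1 big1 ?mulr1 // => k /negPf ->.
by rewrite expr0.
Qed.

Lemma mspan_prod_linear1 j (l : seq F) :
  mspan (fun be => forall k, be k <= (k == j) * size l)%N
        (fun t => \prod_(c <- l) (x j t - c)).
Proof.
elim: l => [|c l ih].
  by apply: mspan_ext (mspan_const 1 _) _ => [k|t]; rewrite ?muln0 // big_nil.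
apply: (@mspan_ext _ (fun t => (x j t + - c) * \prod_(c <- l) (x j t - c))).
  apply: mspanM ih; last first.
    apply: mspanD; first exact: (@mspan_var (fun be => forall k, be k <= (k == j))%N j).
    by apply: mspan_const.
  by move=> al be h1 h2 k /=; rewrite mulnS leq_add.
by move=> t; rewrite big_cons.
Qed.

Lemma mspan_prod_linear (J : seq 'I_s) (a : 'I_s -> F) : uniq J ->
  mspan (fun be => forall k, be k <= (k \in J))%N
        (fun t => \prod_(j <- J) (x j t - a j)).
Proof.
elim: J => [|j J ih] /=.
  by move=> _; apply: mspan_ext (mspan_const 1 _) _ => [k|t] //; rewrite big_nil.
move=> /andP[jJ /ih {}ih].
apply: (@mspan_ext _ (fun t => (x j t + - a j) * \prod_(c <- J) (x c t - a c))).
  apply: mspanM ih; last first.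
    apply: mspanD; first exact: (@mspan_var (fun be => forall k, be k <= (k == j))%N j).
    by apply: mspan_const.
  move=> al be h1 h2 k /=; rewrite inE.
  apply: leq_trans (leq_add (h1 k) (h2 k)) _.
  by case: eqVneq => [->|] //=; rewrite (negPf jJ).
by move=> t; rewrite big_cons.
Qed.

(** The leading monomial cancels, so each remaining one misses a variable of [J]. *)
Lemma mspan_prod_lower (J : seq 'I_s) (a : 'I_s -> F) : uniq J ->
  mspan (fun be => (forall k, be k <= (k \in J))%N /\ exists2 k, k \in J & be k = 0%N)
        (fun t => \prod_(j <- J) x j t - \prod_(j <- J) (x j t - a j)).
Proof.
elim: J => [|j J ih] /=.
  by move=> _; apply: mspan_ext (mspan0 _) _ => t; rewrite !big_nil subrr.
move=> /andP[jJ uJ].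
apply: (@mspan_ext _ (fun t =>
   x j t * (\prod_(c <- J) x c t - \prod_(c <- J) (x c t - a c)) +
   a j * \prod_(c <- J) (x c t - a c))); last first.
  move=> t; rewrite !big_cons /= mulrBr mulrBl -addrA; congr (_ + _).
  by rewrite opprB addrC.
apply: mspanD.
  apply: mspanM (ih uJ); last first.
    exact: (@mspan_var (fun be => forall k, be k <= (k == j))%N j).
  move=> al be h1 [h2 [k0 k0J h3]]; split => [k|] /=.
    rewrite inE; apply: leq_trans (leq_add (h1 k) (h2 k)) _.
    by case: eqVneq => [->|] //=; rewrite (negPf jJ).
  exists k0; first by rewrite inE k0J orbT.
  rewrite h3 addn0; apply/eqP; rewrite -leqn0; apply: leq_trans (h1 _) _.
  by case: eqVneq => // e; rewrite -e k0J in jJ.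
apply: mspanZ; apply: mspanW (mspan_prod_linear a uJ) => be h; split.
  by move=> k; rewrite inE; apply: leq_trans (h k) _; case: (k \in J); rewrite ?orbT.
exists j; first by rewrite inE eqxx.
by apply/eqP; rewrite -leqn0; apply: leq_trans (h j) _; rewrite (negPf jJ).
Qed.

Variables (a : 'I_s -> 'I_s -> F) (c : 'I_s -> F).
Hypothesis a_inj : forall j, injective (a^~ j).

(* Fewer variables than equations: the products have no common zero, since two
   of them would vanish through the same variable.  This is the effective form. *)
Lemma products_comaximal (V I : {set 'I_s}) : (#|V| < #|I|)%N ->
  exists2 h : 'I_s -> T -> F,
    forall i, mspan (fun be => forall j, be j <= (j \in V) * s)%N (h i) &
    forall t, \sum_(i in I) h i t * \prod_(j in V) (x j t - a i j) = 1.
Proof.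
move: {2}#|V| (erefl #|V|) => n; elim: n V I => [|n ih] V I.
  move=> /eqP; rewrite cards_eq0 => /eqP-> ; rewrite cards0 card_gt0 => /set0Pn[i iI].
  exists (fun k t => (k == i)%:R).
    by move=> k; apply: mspan_const.
  move=> t; rewrite (bigD1 i) //= eqxx big_set0 mulr1 big1 ?addr0 //.
  by move=> k /andP[_ /negPf->]; rewrite mul0r.
move=> cV VI.
have /set0Pn[j jV] : V != set0 by rewrite -cards_eq0 cV.
have [|l hl] := @lagrange_partition_of_unity F _ I (a^~ j) (@a_inj j).
  by rewrite -card_gt0 (leq_ltn_trans _ VI).
pose V' := V :\ j.
have cV' : #|V'| = n by move: cV; rewrite (cardsD1 j V) jV => -[].
(* For each [i0], the induction hypothesis is applied with the variable [j] and the equation [i0]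
   removed. *)
have [h hh] : exists h : 'I_s -> 'I_s -> T -> F, forall i0, i0 \in I ->
   (forall i, mspan (fun be => forall j, be j <= (j \in V') * s)%N (h i0 i)) /\
    forall t, \sum_(i in I :\ i0) h i0 i t * \prod_(j in V') (x j t - a i j) = 1.
  suff: forall i0, exists h : 'I_s -> T -> F, i0 \in I ->
   (forall i, mspan (fun be => forall j, be j <= (j \in V') * s)%N (h i)) /\
    forall t, \sum_(i in I :\ i0) h i t * \prod_(j in V') (x j t - a i j) = 1.
    by move=> /fin_all_exists.
  move=> i0; case i0I: (i0 \in I); last by exists (fun _ _ => 0).
  have [||h h1 h2] := ih V' (I :\ i0) => //; last by exists h.
  by move: VI; rewrite cV cV' (cardsD1 i0 I) i0I.
(* The Lagrange term of [i0] contains the factor [x j t - a i j] for each [i != i0]. This factor is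
   taken out to complete the product over [V'] to one over [V]. *)
exists (fun i t => \sum_(i0 in I :\ i) l i0 *
   (h i0 i t * \prod_(k in I :\ i0 :\ i) (x j t - a k j))).
  move=> i; apply: mspan_sum => i0; rewrite !inE => /andP[ii0 i0I].
  apply: mspanZ.
  apply: (@mspanM _ (fun be => forall k, be k <= (k == j) * s)%N) ((hh _ i0I).1 i) _.
    move=> al be h1 h2 k /=; apply: leq_trans (leq_add (h1 k) (h2 k)) _.
    rewrite -mulnDl leq_mul2r /V' !inE.
    by case: (eqVneq k j) => [->|_] /=; rewrite ?jV ?addn0 leqnn orbT.
  apply: (@mspan_ext _ (fun t => \prod_(c <- [seq a k j | k <- enum (I :\ i0 :\ i)]) (x j t - c))).
    apply: mspanW (mspan_prod_linear1 j _) => be hb k; apply: leq_trans (hb k) _.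
    by rewrite leq_mul2l size_map -cardE (leq_trans (max_card _)) ?card_ord // orbT.
  by move=> t; rewrite big_map big_enum.
move=> t; rewrite -[RHS](hl (x j t)).
transitivity (\sum_(i in I) \sum_(i0 in I :\ i)
   l i0 * \prod_(k in I :\ i0) (x j t - a k j) *
     (h i0 i t * \prod_(j in V') (x j t - a i j))).
  apply: eq_bigr => i iI; rewrite mulr_suml; apply: eq_bigr => i0.
  rewrite !inE => /andP[ii0 i0I].
  rewrite (big_setD1 j jV) (big_setD1 i (A := I :\ i0)) /=; last first.
    by rewrite !inE eq_sym ii0.
  rewrite -/V'; move: (\prod_(k in _) _) (\prod_(k in _) _) => p1 p2.
  by ring.
rewrite (exchange_big_dep (mem I)) /=; last by move=> i i0 _; rewrite !inE => /andP[].
apply: eq_bigr => i0 i0I.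
transitivity (l i0 * \prod_(k in I :\ i0) (x j t - a k j) *
    \sum_(i in I :\ i0) h i0 i t * \prod_(j in V') (x j t - a i j)); last first.
  by rewrite (hh _ i0I).2 mulr1.
rewrite mulr_sumr; apply: eq_bigl => i.
by rewrite !inE i0I andbT andbC eq_sym.
Qed.

Hypothesis norm_eq : forall i t, \prod_j (x j t - a i j) = c i.

(* Convex enough that lowering one exponent pays for raising all the exponents
   that stay below it. *)
Definition weight (al : 'I_s -> nat) : nat := (\sum_j s.+2 ^ al j)%N.

(** With [X = s.+2 ^ (al j0).-1], the at most [s] exponents outside [J] and the lowered exponent at
    [j0] cost at most [s.+1 * X], less than the [s.+2 * X] that [j0] contributed before. *)
Lemma weight_lt (al be : 'I_s -> nat) (J : {set 'I_s}) j0 :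
  (forall j, j \in J -> be j <= al j)%N -> j0 \in J -> (be j0 < al j0)%N ->
  (forall k, k \notin J -> be k < al j0)%N -> (weight be < weight al)%N.
Proof.
move=> hJ j0J hj0 hV; rewrite /weight (bigD1 j0) //= [ltnRHS](bigD1 j0) //=.
rewrite (bigID (mem J)) /= [X in (_ < _ + X)%N](bigID (mem J)) /=.
set S1 := (\sum_(i | _ && (i \in J)) s.+2 ^ be i)%N.
set S2 := (\sum_(i | _ && (i \notin J)) s.+2 ^ be i)%N.
set U1 := (\sum_(i | _ && (i \in J)) s.+2 ^ al i)%N.
set U2 := (\sum_(i | _ && (i \notin J)) s.+2 ^ al i)%N.
have h1 : (S1 <= U1)%N.
  by apply: leq_sum => i /andP[_ iJ]; rewrite leq_exp2l ?hJ.
have h2 : (S2 <= s * s.+2 ^ (al j0).-1)%N.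
  rewrite -[s in (s * _)%N]card_ord -sum_nat_const.
  apply: (@leq_trans (\sum_(i | (i != j0) && (i \notin J)) s.+2 ^ (al j0).-1)%N).
    apply: leq_sum => i /andP[_ iJ]; rewrite leq_exp2l // -ltnS.
    by rewrite (ltn_predK hj0) hV.
  by rewrite [leqRHS](bigID (fun i => (i != j0) && (i \notin J))) /= leq_addr.
have h3 : (s.+2 ^ be j0 <= s.+2 ^ (al j0).-1)%N.
  by rewrite leq_exp2l // -ltnS (ltn_predK hj0).
rewrite -(ltn_predK hj0) expnS.
have : (0 < s.+2 ^ (al j0).-1)%N by rewrite expn_gt0.
move: h2 h3; set X := (_ ^ (al j0).-1)%N; set Y := (_ ^ _)%N.
move: h1; lia.
Qed.

(* A gap in the exponents: rewrite the product of the variables in [J] with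
   [products_comaximal] and the equations of the system. *)
Lemma monomial_reduce (al : 'I_s -> nat) (J : {set 'I_s}) : J != set0 ->
  (forall j, j \in J -> 0 < al j)%N ->
  (forall j k, j \in J -> k \notin J -> al k + s.+2 <= al j)%N ->
  mspan (fun be => weight be < weight al)%N (monomial al).
Proof.
move=> J0 alJ gap.
have [|h h1 h2] := @products_comaximal (~: J) [set: 'I_s].
  by rewrite cardsT -(cardsC J) -{1}[#|~: J|]add0n ltn_add2r card_gt0.
pose ga j := (al j - (j \in J))%N.
(* Multiply by the partition of unity [h] and split the product of the variables in [J] as [low i]
   plus the product of the [x j t - a i j]. The second part completes the product over [~: J] to the
   full one, which is [c i]. *)
pose low i t := \prod_(j in J) x j t - \prod_(j in J) (x j t - a i j).
apply: (@mspan_ext _ (fun t => \sum_(i in [set: 'I_s])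
   (h i t * (monomial ga t * (\prod_(j in ~: J) (x j t - a i j) * low i t))
    + c i * (h i t * monomial ga t)))); last first.
  move=> t; transitivity (monomial ga t * \prod_(j in J) x j t).
    transitivity (monomial ga t * \prod_(j in J) x j t *
      \sum_(i in [set: 'I_s]) h i t * \prod_(j in ~: J) (x j t - a i j)); last first.
      by rewrite h2 mulr1.
    rewrite mulr_sumr; apply: eq_bigr => i _.
    have -> : c i = \prod_(j in J) (x j t - a i j) * \prod_(j in ~: J) (x j t - a i j).
      rewrite -(norm_eq i t) (bigID (mem J)) /=; congr (_ * _).
      by apply: eq_bigl => j; rewrite inE.
    by rewrite /low; ring.
  rewrite /monomial [X in _ * X]big_mkcond -big_split /=; apply: eq_bigr => j _.
  rewrite /ga; case jJ: (j \in J); last by rewrite mulr1 subn0.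
  by rewrite -exprSr subn1 prednK // alJ.
(* Outside [J], [h] raises an exponent by at most [s] and the linear factors by at most 1; the gap
   [s.+2] keeps the result below every exponent in [J]. *)
pose R be := [/\ forall j, j \in J -> (be j <= al j)%N,
   exists2 j, j \in J & (be j < al j)%N &
   forall k, k \notin J -> (be k <= al k + s.+1)%N].
apply: (@mspanW R).
  move=> be [r1 [j0 j0J r2] r3]; apply: (weight_lt r1 j0J r2) => k kJ.
  by apply: leq_trans (gap _ _ j0J kJ); rewrite addnS ltnS r3.
have ga_le j : (ga j <= al j)%N by rewrite /ga leq_subr.
apply: mspan_sum => i _; apply: mspanD.
  apply: (@mspanM _ (fun be => [/\ forall j, j \in J -> (be j <= al j)%N,
   exists2 j, j \in J & (be j < al j)%N &
   forall k, k \notin J -> (be k <= al k + 1)%N])) (h1 i) _.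
    move=> b1 b2 H1 [H2 [j j0J H3] H4]; split => [k kJ||k kJ].
    - by move: (H1 k); rewrite inE kJ /= leqn0 => /eqP->; apply: H2.
    - by exists j => //; move: (H1 j); rewrite inE j0J /= leqn0 => /eqP->.
    - by move: (H1 k) (H4 k kJ); rewrite inE kJ mul1n; lia.
  apply: (@mspanM (fun be => be = ga) (fun be =>
     (forall k, be k <= 1)%N /\ exists2 j, j \in J & be j = 0%N)).
  - move=> _ b2 -> [H2 [j jJ H3]]; split => [k kJ||k kJ].
    + by move: (H2 k) (alJ k kJ); rewrite /ga kJ; lia.
    + by exists j => //; rewrite H3 /ga jJ; move: (alJ j jJ); lia.
    + by rewrite leq_add.
  - exact: mspan_mon.
  - have Hu := mspan_prod_linear (a i) (enum_uniq (~: J)).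
    have Hl := mspan_prod_lower (a i) (enum_uniq J).
    apply: (@mspan_ext _ (fun t => \prod_(j <- enum (~: J)) (x j t - a i j) *
     (\prod_(j <- enum J) x j t - \prod_(j <- enum J) (x j t - a i j)))); last first.
      by move=> t; rewrite !big_enum.
    apply: mspanM Hu Hl => b1 b2 H1 [H2 [j jJ H3]]; rewrite mem_enum in jJ; split.
      move=> k; move: (H1 k) (H2 k); rewrite !mem_enum inE.
      by case: (k \in J) => /=; lia.
    by exists j => //; move: (H1 j); rewrite mem_enum inE jJ H3 addn0 leqn0 => /eqP.
apply: mspanZ; apply: (@mspanM _ (fun be => be = ga)) (h1 i) _; last exact: mspan_mon.
move=> b1 _ H1 ->; split => [k kJ||k kJ].
- by move: (H1 k); rewrite inE kJ /= leqn0 => /eqP->; apply: ga_le.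
- have /set0Pn[j jJ] := J0; exists j => //.
  move: (H1 j); rewrite inE jJ /= leqn0 => /eqP->.
  by move: (alJ j jJ); rewrite /ga jJ; lia.
- by move: (H1 k) (ga_le k); rewrite inE kJ mul1n; lia.
Qed.

(** One more than the right end of the last of [s] consecutive windows of length [s.+2]. *)
Definition degree_bound : nat := (s * s.+2).+1.

(** Induction on the weight. An exponent that is too large lies beyond all [s] windows, so some
    window contains no exponent, and the variables above this window form the set [J] to be
    reduced. *)
Lemma monomial_box (al : 'I_s -> nat) :
  mspan (fun be => forall j, be j < degree_bound)%N (monomial al).
Proof.
move: {2}(weight al) (leqnn (weight al)) => n; elim/ltn_ind: n al => n ih al le_n.
case: (boolP [forall j, al j < degree_bound]%N) => [/forallP h|]; first exact: mspan_mon.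
rewrite negb_forall => /existsP[j0]; rewrite -leqNgt => hj0.
have [k hk] : exists k : 'I_s, forall j, ~~ (k * s.+2 < al j <= k.+1 * s.+2)%N.
  suff /existsP[k /forallP hk] : [exists k : 'I_s, forall j, ~~ (k * s.+2 < al j <= k.+1 * s.+2)%N].
    by exists k.
  apply: contraT; rewrite negb_exists => /forallP hn.
  (* If every window held an exponent, [g] would be injective, hence onto, and [j0] would lie in a
     window. *)
  have [g hg] : exists g : 'I_s -> 'I_s, forall k : 'I_s,
      (k * s.+2 < al (g k) <= k.+1 * s.+2)%N.
    suff : forall k : 'I_s, exists j : 'I_s, (k * s.+2 < al j <= k.+1 * s.+2)%N.
      by move=> /fin_all_exists.
    move=> k; have := hn k; rewrite negb_forall => /existsP[j].
    by rewrite negbK; exists j.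
  have g_inj : injective g.
    move=> k1 k2 e; apply/val_inj => /=.
    have /andP[a1 a2] := hg k1; have /andP[b1 b2] := hg k2.
    rewrite e in a1 a2; apply/eqP; rewrite eqn_leq.
    have := leq_trans a1 b2; have := leq_trans b1 a2.
    by rewrite !ltn_pmul2r // !ltnS => -> ->.
  have /codomP[k e] : j0 \in codom g by apply: (injF_onto g_inj).
  have /andP[_ b2] := hg k; rewrite -e in b2.
  have := leq_trans hj0 b2; rewrite /degree_bound ltn_pmul2r // ltnS leqNgt ltn_ord; by [].
pose J := [set j | k.+1 * s.+2 < al j]%N.
apply: (@mspan_sub (fun be => weight be < weight al)%N).
  by move=> be hbe; apply: (ih (weight be)) => //; apply: leq_trans hbe le_n.
apply: (@monomial_reduce al J).
- apply/set0Pn; exists j0; rewrite inE; apply: leq_trans hj0.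
  by rewrite /degree_bound ltnS leq_mul2r ltn_ord orbT.
- by move=> j; rewrite inE => h; apply: leq_trans h.
- move=> i j; rewrite !inE -leqNgt => h1 h2.
  have := hk j; rewrite h2 andbT -leqNgt => h3.
  by move: h1; rewrite mulSn; lia.
Qed.

End NormSystem.

(** The coordinate [x j0] separates the points of [T], so every function on [T] is polynomial in it,
    and by [monomial_box] a combination of the [degree_bound s ^ s] monomials of the box. Counting
    functions takes the place of comparing dimensions. *)
Lemma norm_system_card (F : finFieldType) (T : finType) (s : nat)
    (x : 'I_s -> T -> F) (a : 'I_s -> 'I_s -> F) (c : 'I_s -> F) (j0 : 'I_s) :
  (forall j, injective (a^~ j)) -> injective (x j0) ->
  (forall i t, \prod_j (x j t - a i j) = c i) ->
  (#|T| <= degree_bound s ^ s)%N.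
Proof.
move=> a_inj x_inj eqn.
have spanT g : mspan x (fun=> True) g.
  (* Indicators of points are Lagrange polynomials in [x j0]. *)
  have delta t0 : mspan x (fun=> True) (fun t => (t == t0)%:R).
    apply: (@mspan_ext _ _ _ _ _ (fun t => (\prod_(u in [set~ t0]) (x j0 t0 - x j0 u))^-1 *
      \prod_(k <- [seq x j0 u | u <- enum [set~ t0]]) (x j0 t - k))).
      by apply: mspanZ; apply: mspanW (mspan_prod_linear1 x j0 _).
    move=> t; rewrite big_map big_enum /=; case: eqVneq => [->|tt0].
      rewrite mulVf //; apply/prodf_neq0 => u; rewrite !inE => ut0.
      by rewrite subr_eq0 (inj_eq x_inj) eq_sym.
    by rewrite [X in _ * X](big_setD1 t) ?inE //= subrr mul0r mulr0.
  apply: (@mspan_ext _ _ _ _ _ (fun t => \sum_(t0 : T) g t0 * (t == t0)%:R)).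
    by apply: mspan_sum => t0 _; apply: mspanZ.
  move=> t; rewrite (bigD1 t) //= eqxx mulr1 big1 ?addr0 // => u.
  by rewrite eq_sym => /negPf->; rewrite mulr0.
have spanB g : mspan x (fun be => forall j, be j < degree_bound s)%N g.
  by apply: mspan_sub (spanT g) => al _; apply: (monomial_box a_inj eqn).
pose E := {ffun 'I_s -> 'I_(degree_bound s)}.
pose Phi (f : {ffun E -> F}) : {ffun T -> F} :=
  [ffun t => \sum_(al : E) f al * monomial x (fun j => al j : nat) t].
have Phi_onto (g : {ffun T -> F}) : g \in codom Phi.
  suff [f hf] : exists f : {ffun E -> F},
      forall t, g t = \sum_(al : E) f al * monomial x (fun j => al j : nat) t.
    by apply/codomP; exists f; apply/ffunP => t; rewrite hf ffunE.
  elim: (spanB g) => [be hbe||g1 g2 _ [f1 h1] _ [f2 h2]|k g1 _ [f1 h1]|g1 g2 _ [f1 h1] e].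
  - pose be' : E := [ffun j => Ordinal (hbe j)].
    exists [ffun al => (al == be')%:R] => t.
    rewrite (bigD1 be') //= ffunE eqxx mul1r big1 => [|al /negPf hal].
      by rewrite addr0; apply: eq_bigr => j _; rewrite ffunE.
    by rewrite ffunE hal mul0r.
  - by exists [ffun=> 0] => t; rewrite big1 // => al _; rewrite ffunE mul0r.
  - exists [ffun al => f1 al + f2 al] => t; rewrite h1 h2 -big_split /=.
    by apply: eq_bigr => al _; rewrite ffunE mulrDl.
  - exists [ffun al => k * f1 al] => t; rewrite h1 mulr_sumr.
    by apply: eq_bigr => al _; rewrite ffunE mulrA.
  - by exists f1 => t; rewrite -e.
have : (#|{: {ffun T -> F}}| <= #|{: {ffun E -> F}}|)%N.
  apply: leq_trans (leq_image_card Phi predT).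
  by apply: subset_leq_card; apply/subsetP => g _; apply: Phi_onto.
by rewrite !card_ffun !card_ord leq_exp2l // finNzRing_gt1.
Qed.

(* [chi x y] is the norm of [x + y] in [GF(q^s)] over [GF(q)], where [q = 2^k]. *)
Lemma norm_coloring (s k : nat) : (0 < s)%N -> (0 < k)%N ->
  exists chi : 'I_(2 ^ (k * s)) -> 'I_(2 ^ (k * s)) -> 'I_(2 ^ k),
    (forall x y, chi x y = chi y x) /\
    forall (c : 'I_(2 ^ k)) (A : {set 'I_(2 ^ (k * s))}), #|A| = s ->
      (#|[set x | [forall a in A, chi a x == c]]| <= degree_bound s ^ s)%N.
Proof.
move=> s0 k0.
have ks0 : (0 < k * s)%N by rewrite muln_gt0 k0.
have [F ch2 cardF] := pPrimePowerField (isT : prime 2) ks0.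
pose q := (2 ^ k)%N.
have frobD j (y z : F) : (y + z) ^+ (q ^ j) = y ^+ (q ^ j) + z ^+ (q ^ j).
  apply: exprDn_pchar; rewrite (eq_pnat _ (pcharf_eq ch2)) /q -expnM.
  by rewrite pnatX pnat_id.
have frob_inj j : injective (fun y : F => y ^+ (q ^ j)).
  move=> y z /= e; apply/eqP; rewrite -subr_eq0.
  have e2 : - z = z by apply/eqP; rewrite eq_sym -addr_eq0 -mulr2n -mulr_natr (pcharf0 ch2) mulr0.
  have : (y - z) ^+ (q ^ j) == 0.
    by rewrite frobD e e2 -mulr2n -mulr_natr (pcharf0 ch2) mulr0.
  by rewrite expf_eq0 => /andP[].
pose N (z : F) := \prod_(j < s) z ^+ (q ^ j).
(* Raising to the power [q] permutes the factors cyclically, the last one returning to [z] because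
   [#|F| = q ^ s]. *)
have Nq z : N z ^+ q = N z.
  rewrite /N -prodrXl; case: s s0 @N cardF {ks0} => // s' _ N cardF.
  rewrite big_ord_recr big_ord_recl /= mulrC; congr (_ * _).
    rewrite -exprM -expnSr expn0 expr1 -[RHS](expf_card z); congr (_ ^+ _).
    by rewrite cardF /q -expnM.
  by apply: eq_bigr => j _; rewrite -exprM -expnSr.
(* Norms are roots of [X^q - X], which has at most [q] roots; the position of a norm in [r] serves
   as its colour. *)
pose r := enum [pred y : F | y ^+ q == y].
have sr : (size r <= q)%N.
  have q1 : (1 < q)%N by rewrite /q -{1}(expn0 2) ltn_exp2l.
  have sz : size ('X^q - 'X : {poly F}) = q.+1.
    by rewrite size_polyDl size_polyXn // size_polyN size_polyX.
  have := @max_poly_roots _ ('X^q - 'X : {poly F}) r.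
  rewrite sz ltnS; apply.
  - by rewrite -size_poly_eq0 sz.
  - by apply/allP => y; rewrite mem_enum inE => /eqP e; rewrite rootE !hornerE ?hornerXn e subrr.
  - exact: enum_uniq.
have Nr z : N z \in r by rewrite mem_enum inE Nq.
have cI : forall z, (index (N z) r < 2 ^ k)%N.
  by move=> z; apply: leq_trans sr; rewrite index_mem.
have eF : #|F| = (2 ^ (k * s))%N := cardF.
pose v (i : 'I_(2 ^ (k * s))) : F := enum_val (cast_ord (esym eF) i).
have v_inj : injective v by move=> i j /enum_val_inj /cast_ord_inj.
exists (fun x y => Ordinal (cI (v x + v y))); split.
  by move=> x y; apply/val_inj; rewrite /= addrC.
move=> c A cardA.
set S := [set x | _].
pose ai (i : 'I_s) : 'I_(2 ^ (k * s)) := enum_val (cast_ord (esym cardA) i).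
have ai_inj : injective ai by move=> i j /enum_val_inj /cast_ord_inj.
rewrite -[#|S|](card_sig (mem S)).
(* The variables are the conjugates of a point; additivity of Frobenius turns the norm of
   [v (ai i) + v (val t)] into the product of the [x j t - a i j]. *)
apply: (@norm_system_card F {x | x \in S} s (fun j t => v (val t) ^+ (q ^ j))
  (fun i j => - v (ai i) ^+ (q ^ j)) (fun=> nth 0 r c) (Ordinal s0)).
- by move=> j i1 i2 /oppr_inj /frob_inj /v_inj /ai_inj.
- by move=> t1 t2 /frob_inj /v_inj /val_inj.
- move=> i [t] /=; rewrite inE => /forall_inP/(_ (ai i)).
  rewrite enum_valP => /(_ isT) /eqP e.
  rewrite -e /= nth_index // /N; apply: eq_bigr => j _.
  by rewrite frobD opprK addrC.
Qed.

(** * The random graph *)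

Section RandomSubset.
Variables (R : realFieldType) (T : finType) (P : {set T}).

(** Independence of the elements, as an expanded product. It serves as moment generating function
    and, for empty [S], gives total mass 1. *)
Lemma random_subset_prod (p x y : R) (S : {set T}) : S \subset P ->
  \sum_(G : {set T} | G \subset P) p ^+ #|G| * (1 - p) ^+ (#|P| - #|G|) *
      \prod_(i in S) (if i \in G then x else y)
    = (p * x + (1 - p) * y) ^+ #|S|.
Proof.
move=> SP.
(* [F] vanishes outside [P], which removes the subsets not contained in [P]. *)
pose F i : R := if i \in P then p * (if i \in S then x else 1) else 0.
pose H i : R := if i \in P then (1 - p) * (if i \in S then y else 1) else 1.
transitivity (\prod_i (F i + H i)); last first.
  rewrite -prodr_const [RHS]big_mkcond /=; apply: eq_bigr => i _; rewrite /F /H.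
  have := subsetP SP i; case: (i \in S) => [->//|_].
  by case: (i \in P) => //; rewrite ?add0r // !mulr1 addrC subrK.
rewrite bigA_distr [RHS](bigID (fun G : {set T} => G \subset P)) /=.
rewrite [X in _ = _ + X]big1 ?addr0; last first.
  move=> G /subsetPn[i iG iP]; rewrite (bigD1 i) //= iG /F (negPf iP).
  by rewrite mul0r.
apply: eq_bigr => G GP.
have -> : (#|P| - #|G| = #|P :\: G|)%N by rewrite cardsD (setIidPr GP).
rewrite -!prodr_const !(big_mkcond (fun i => i \in _)) /= -!big_split /=.
apply: eq_bigr => i _; rewrite /F /H !inE.
have := subsetP GP i; have := subsetP SP i.
case: (i \in G); case: (i \in S); case: (i \in P) => //=; rewrite ?mulr1 ?mul1r //.
all: by move=> a b; first [have := a isT | have := b isT].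
Qed.

Lemma sum_subset_pow (y : R) : \sum_(W : {set T}) y ^+ #|W| = (1 + y) ^+ #|T|.
Proof.
transitivity (\prod_(i : T) (y + 1)); last by rewrite prodr_const addrC.
rewrite bigA_distr; apply: eq_bigr => W _.
by rewrite -prodr_const big_mkcond.
Qed.

End RandomSubset.

Lemma exp1D_le (R : realFieldType) (y : R) n : 0 <= y -> 2 * n%:R * y <= 1 ->
  (1 + y) ^+ n <= 1 + 2 * n%:R * y.
Proof.
move=> y0; elim: n => [|n ih]; first by rewrite expr0 mulr0 mul0r addr0.
rewrite -natr1 => h; rewrite exprSr.
have h1 : 2 * n%:R * y <= 1 by nra.
apply: le_trans (ler_wpM2r _ (ih h1)) _; first by lra.
have : 0 <= n%:R :> R by []. 
nra.
Qed.

(** * Large deviations and the union bound in the random graph *)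

Section Probability.
Variables (R : realType) (n : nat) (p : R).
Hypothesis p01 : 0 < p < 1.
Let P := pairs n.
Let w (G : {set {set 'I_n}}) : R := p ^+ #|G| * (1 - p) ^+ (#|P| - #|G|).

Let w_ge0 G : 0 <= w G.
Proof.
by case/andP: p01 => p0 p1; rewrite mulr_ge0 // exprn_ge0 ?subr_ge0 // ltW.
Qed.

Lemma Gnp_prob_compl (E : {set {set 'I_n}} -> bool) :
  Gnp_prob p E = 1 - Gnp_prob p (fun G => ~~ E G).
Proof.
apply/eqP; rewrite eq_sym subr_eq; apply/eqP; rewrite /Gnp_prob.
have := random_subset_prod p 1 1 (sub0set P).
rewrite cards0 expr0 => tot; rewrite -[LHS]tot (bigID E) /=.
by congr (_ + _); apply: eq_bigr => G _; rewrite big_set0 mulr1.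
Qed.

Lemma le_Gnp_prob (E E' : {set {set 'I_n}} -> bool) :
  (forall G : {set {set 'I_n}}, G \subset P -> E G -> E' G) -> Gnp_prob p E <= Gnp_prob p E'.
Proof.
move=> EE'; rewrite /Gnp_prob [leRHS](bigID E) /=.
rewrite [leLHS](eq_bigl (fun G : {set {set 'I_n}} => (G \subset pairs n) && E' G && E G)).
  by rewrite lerDl; apply: sumr_ge0 => *; exact: w_ge0.
move=> G; case GP: (G \subset _) => //=.
by case EG: (E G); rewrite ?andbF // andbT EE'.
Qed.

Lemma Gnp_prob_union (I : finType) (A : pred I) (E : I -> {set {set 'I_n}} -> bool) :
  Gnp_prob p (fun G => [exists i in A, E i G]) <= \sum_(i in A) Gnp_prob p (E i).
Proof.
rewrite /Gnp_prob (exchange_big_dep (fun G : {set {set 'I_n}} => G \subset P)) /=; last first.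
  by move=> i G _ /andP[].
rewrite big_mkcondr /=; apply: ler_sum => G GP.
case: ifP => [/exists_inP[i iA EiG]|_]; last by apply: sumr_ge0 => *; exact: w_ge0.
rewrite (bigD1 i) /=; last by rewrite iA GP EiG.
by rewrite lerDl; apply: sumr_ge0 => *; exact: w_ge0.
Qed.

(* Exponential Markov inequality with base 2, using [2 <= (1 + 1/k)^k]. *)
Lemma Gnp_prob_few (S : {set {set 'I_n}}) (k : nat) (b : bool) (th : R) :
  S \subset P -> (0 < k)%N -> p / 2 + (1 - p) <= th -> p + (1 - p) / 2 <= th ->
  Gnp_prob p (fun G => (k * #|[set e in S | (e \in G) == b]| < #|S|)%N)
   <= (th * (1 + k%:R^-1)) ^+ #|S|.
Proof.
move=> SP k0 h1 h2; case/andP: p01 => p0 p1.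
(* Each pair of status [b] is charged a factor [1 / 2]; [th] bounds the mean of one factor for
   either value of [b]. *)
pose x : R := if b then 1 / 2 else 1; pose y : R := if b then 1 else 1 / 2.
have k1 : 0 <= k%:R^-1 :> R by rewrite invr_ge0.
have two_le : 2 <= (1 + k%:R^-1) ^+ k :> R.
  have bern j : 1 + j%:R * k%:R^-1 <= (1 + k%:R^-1) ^+ j :> R.
    elim: j => [|j ih]; first by rewrite mul0r addr0 expr0.
    rewrite exprSr -natr1; apply: le_trans (ler_wpM2r _ ih); last by lra.
    have : 0 <= j%:R :> R by []. 
    by nra.
  by have := bern k; rewrite mulfV ?pnatr_eq0 ?lt0n_neq0 //; lra.
rewrite exprMn.
apply: (@le_trans _ _ ((p * x + (1 - p) * y) ^+ #|S| * (1 + k%:R^-1) ^+ #|S|));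
  last first.
  apply: ler_wpM2r; first by rewrite exprn_ge0 // addr_ge0.
  by apply: lerXn2r; rewrite ?nnegrE /x /y; case: (b); lra.
rewrite -(random_subset_prod _ _ _ SP) mulr_suml /Gnp_prob big_mkcondr /=.
apply: ler_sum => G GP; rewrite -/(w G).
have xy0 e : 0 <= (if e \in G then x else y) by rewrite /x /y; case: ifP; case: (b); lra.
have k2 : 0 <= 1 + k%:R^-1 :> R by rewrite addr_ge0.
case: ifP => [few|_]; last first.
  by rewrite mulr_ge0 ?exprn_ge0 // mulr_ge0 ?w_ge0 // prodr_ge0.
rewrite -mulrA ler_peMr ?w_ge0 //.
set B := [set e in S | _] in few.
have -> : \prod_(i in S) (if i \in G then x else y) = (1 / 2) ^+ #|B|.
  rewrite -prodr_const (big_mkcond (fun i => i \in S)) [RHS]big_mkcond /=.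
  apply: eq_bigr => e _; rewrite !inE /x /y.
  by case: (e \in S) => //=; case: (e \in G); case: (b).
apply: (@le_trans _ _ ((1 / 2) ^+ #|B| * (1 + k%:R^-1) ^+ (k * #|B|))).
  rewrite exprM -exprMn exprn_ege1 //; lra.
apply: ler_wpM2l; first by rewrite exprn_ge0 //; lra.
by apply: ler_weXn2l; [lra | exact: ltnW].
Qed.

Definition inner_pairs (W : {set 'I_n}) := [set e in pairs n | e \subset W].

Lemma card_inner_pairs W : #|inner_pairs W| = 'C(#|W|, 2).
Proof. by rewrite -cards_draws; apply: eq_card => e; rewrite !inE andbC. Qed.

Definition balanced (k m : nat) (G : {set {set 'I_n}}) :=
  [forall W : {set 'I_n}, forall b : bool, (m <= #|W|)%N ==>
    (#|inner_pairs W| <= k * #|[set e in inner_pairs W | (e \in G) == b]|)%N].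

(** For [#|W| > 2 * h] there are at least [h * #|W|] inner pairs, so [W] fails for a given [b] with
    probability at most [(rho ^+ h) ^+ #|W|]. Summed over nonempty [W] this is
    [(1 + rho ^+ h) ^+ n - 1], at most [2 * n * rho ^+ h]; the two values of [b] double it. *)
Lemma Gnp_prob_balanced (k h : nat) (th : R) :
  (0 < k)%N -> p / 2 + (1 - p) <= th -> p + (1 - p) / 2 <= th ->
  th * (1 + k%:R^-1) <= 1 -> (2 * n%:R * (th * (1 + k%:R^-1)) ^+ h) <= 1 ->
  1 - 4 * n%:R * (th * (1 + k%:R^-1)) ^+ h <= Gnp_prob p (balanced k (2 * h).+1).
Proof.
move=> k0 th1 th2; set rho := th * _ => rho1 small.
have rho0 : 0 <= rho.
  by rewrite mulr_ge0 ?addr_ge0 ?invr_ge0 //; case/andP: p01; lra.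
rewrite Gnp_prob_compl lerD2l lerN2.
pose few (Wb : {set 'I_n} * bool) (G : {set {set 'I_n}}) :=
  (k * #|[set e in inner_pairs Wb.1 | (e \in G) == Wb.2]| < #|inner_pairs Wb.1|)%N.
pose A := [set Wb : {set 'I_n} * bool | (2 * h < #|Wb.1|)%N].
apply: (@le_trans _ _ (Gnp_prob p (fun G => [exists i in A, few i G]))).
  apply: le_Gnp_prob => G _; rewrite negb_forall => /existsP[W].
  rewrite negb_forall => /existsP[b]; rewrite negb_imply -ltnNge => /andP[hW hb].
  by apply/exists_inP; exists (W, b); rewrite ?inE.
apply: le_trans (Gnp_prob_union _ _) _.
apply: (@le_trans _ _ (\sum_(Wb in A) (rho ^+ h) ^+ #|Wb.1|)).
  apply: ler_sum => -[W b]; rewrite inE /= => hW.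
  apply: le_trans (Gnp_prob_few b _ k0 th1 th2) _.
    by apply/subsetP => e; rewrite inE => /andP[].
  rewrite -/rho -exprM; apply: ler_wiXn2l => //.
  rewrite card_inner_pairs bin2 /= -(doubleK (h * #|W|)%N) half_leq //.
  by rewrite -muln2 mulnAC mulnC leq_mul2l mulnC -ltnS (ltn_predK hW) hW orbT.
have y0 : 0 <= rho ^+ h by apply: exprn_ge0.
apply: (@le_trans _ _ (\sum_(W : {set 'I_n} | W != set0) \sum_(b : bool) (rho ^+ h) ^+ #|W|)).
  rewrite pair_big_dep /= [leRHS](bigID (fun Wb => Wb \in A)) /=.
  rewrite [leLHS](eq_bigl (fun Wb : {set 'I_n} * bool => (Wb.1 != set0) && true && (Wb \in A))).
    by rewrite lerDl; apply: sumr_ge0 => *; apply: exprn_ge0.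
  move=> [W b]; rewrite !inE andbT /=.
  by case: eqVneq => [->|] //=; rewrite cards0.
rewrite (eq_bigr (fun W : {set 'I_n} => 2 * (rho ^+ h) ^+ #|W|)); last first.
  by move=> W _; rewrite big_bool /= mulrDl mul1r.
rewrite -mulr_sumr.
have := sum_subset_pow 'I_n (rho ^+ h).
rewrite card_ord (bigD1 set0) //= cards0 expr0.
have := exp1D_le y0 small.
set X := (1 + _) ^+ n; set Y := \sum_(W | _) _; set Z := rho ^+ h.
by move=> hX hY; nra.
Qed.

End Probability.

(** The constant 8: for [#|W| >= 2], [2 * #|W| ^ 2] is at most 8 times the number of inner pairs,
    and each pair of status [b] yields an ordered pair related by [e]. *)
Lemma balanced_dense n k m G : (1 < m)%N -> @balanced n k m G ->
  dense_rel m (8 * k) (adj G) /\ dense_rel m (8 * k) (nonadj G).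
Proof.
move=> m1 bal.
suff H (b : bool) (e : rel 'I_n) :
    (forall u v, u != v -> ([set u; v] \in G) == b -> e u v) ->
    dense_rel m (8 * k) e.
  split; first by apply: (H true) => u v _ /eqP.
  by apply: (H false) => u v uv; rewrite /nonadj uv eqbF_neg.
move=> he W mW; have := forallP (forallP bal W) b; rewrite mW /=.
set B := [set E in _ | _]; rewrite card_inner_pairs bin2.
have hB : (#|B| <= \sum_(v in W) #|W :&: [set u | e v u]|)%N.
  pose P := [set p : 'I_n * 'I_n | [&& p.1 \in W, p.2 \in W & e p.1 p.2]].
  have -> : (\sum_(v in W) #|W :&: [set u | e v u]| = #|P|)%N.
    rewrite -sum1_card (eq_bigl (fun p => (p.1 \in W) && ((p.2 \in W) && e p.1 p.2))).
      rewrite -(pair_big_dep (mem W) (fun u v => (v \in W) && e u v) (fun _ _ => 1%N)) /=.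
      by apply: eq_bigr => v _; rewrite -sum1_card; apply: eq_bigl => u; rewrite !inE.
    by move=> q; rewrite inE.
  apply: leq_trans (leq_imset_card (fun p : 'I_n * 'I_n => [set p.1; p.2]) P).
  apply: subset_leq_card; apply/subsetP => E.
  rewrite !inE => /andP[/andP[/cards2P[u [v [uv Euv]]] EW] Eb].
  apply/imsetP; exists (u, v) => //=; rewrite inE /=.
  rewrite Euv in EW Eb; rewrite he // andbT.
  by rewrite !(subsetP EW) // !inE eqxx ?orbT.
move=> h1.
have W2 : (2 <= #|W|)%N by apply: leq_trans mW.
have h2 : (#|W| * #|W|.-1 <= 2 * (k * #|B|))%N.
  have ev : ~~ odd (#|W| * #|W|.-1).
    by rewrite oddM; case: (#|W|) W2 => //= j _; case: (odd j).
  by rewrite -(even_halfK ev) -mul2n leq_mul2l h1.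
have h3 : (k * #|B| <= k * \sum_(v in W) #|W :&: [set u | e v u]|)%N.
  by rewrite leq_mul2l hB orbT.
have h4 : (2 * #|W| ^ 2 <= 4 * (#|W| * #|W|.-1))%N.
  by rewrite -mulnn; case: (#|W|) W2 => [|[|j]] //= _; nia.
rewrite -mulnA; apply: (leq_trans h4).
apply: (@leq_trans (4 * (2 * (k * #|B|)))%N); first by rewrite leq_mul2l h2.
by rewrite mulnA leq_mul2l h3.
Qed.

(** Packages all the probability: an event implied by both densities holds with high probability,
    with [a] and [b] depending on [p] only. The density constant is a power of 2 to ease later
    choices of parameters. *)
Lemma Gnp_dense (R : realType) (p : R) : 0 < p < 1 ->
  exists a b : nat, [/\ (0 < a)%N, (0 < b)%N & forall eps : R, 0 < eps ->
  exists N : nat, forall n : nat, (N <= n)%N ->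
    forall E : {set {set 'I_n}} -> bool,
    (forall G : {set {set 'I_n}}, G \subset pairs n ->
      dense_rel (2 * (a * (trunc_log 2 n).+1)).+1 (2 ^ b) (adj G) ->
      dense_rel (2 * (a * (trunc_log 2 n).+1)).+1 (2 ^ b) (nonadj G) -> E G) ->
    1 - eps <= Gnp_prob p E].
Proof.
move=> p01; have /andP[p0 p1] := p01.
pose th : R := 1 - Num.min p (1 - p) / 2.
have mn : 0 < Num.min p (1 - p) by rewrite lt_min p0 subr_gt0.
have mle : Num.min p (1 - p) <= p by rewrite ge_min lexx.
have mle' : Num.min p (1 - p) <= 1 - p by rewrite ge_min lexx orbT.
have th1 : p / 2 + (1 - p) <= th by rewrite /th; lra.
have th2 : p + (1 - p) / 2 <= th by rewrite /th; lra.
have th3 : 0 < th < 1 by rewrite /th; apply/andP; split; lra.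
case/andP: th3 => th0 thlt1.
have [kap hkap] : exists kap : nat, th * (1 + (2 ^ kap)%:R^-1) < 1.
  exists (Num.bound (th / (1 - th))); set kap := Num.bound _.
  have hb : th / (1 - th) < kap%:R.
    apply: archi_boundP; apply: divr_ge0; first exact: ltW.
    by rewrite subr_ge0 ltW.
  have k2 : kap%:R < (2 ^ kap)%:R :> R by rewrite ltr_nat ltn_expl.
  have kpos : 0 < (2 ^ kap)%:R :> R by rewrite ltr0n expn_gt0.
  have h3 : th < (1 - th) * (2 ^ kap)%:R.
    by rewrite mulrC -ltr_pdivrMr ?subr_gt0 //; apply: lt_trans k2.
  by rewrite mulrDr mulr1 -ltrBrDl ltr_pdivrMr.
set k := (2 ^ kap)%N in hkap; set rho := th * _ in hkap.
have k0 : (0 < k)%N by rewrite expn_gt0.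
have rho0 : 0 < rho by rewrite mulr_gt0 // addr_gt0 // invr_gt0 ltr0n.
(* The value [1 / 4] makes [rho ^+ (a * l.+1)] at most [n ^ -2], so that the failure probability is
   at most [4 / n]. *)
have [a a0 ha] : exists2 a : nat, (0 < a)%N & rho ^+ a <= 1 / 4.
  pose z := rho^-1 - 1.
  have z0 : 0 < z by rewrite /z subr_gt0 -[1]invr1 ltf_pV2 // ?posrE.
  have bern j : 1 + j%:R * z <= rho^-1 ^+ j.
    elim: j => [|j ih]; first by rewrite mul0r addr0 expr0.
    have -> : rho^-1 ^+ j.+1 = rho^-1 ^+ j * (1 + z) by rewrite exprSr /z addrC subrK.
    rewrite -natr1; apply: le_trans (ler_wpM2r _ ih); last by lra.
    have : 0 <= j%:R :> R by [].
    by nra.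
  exists (Num.bound (4 / z)).+1 => //; set j := (Num.bound _).+1.
  have hb : 4 / z < j%:R.
    apply: lt_trans (archi_boundP _) _; first by apply: divr_ge0 => //; apply: ltW.
    by rewrite ltr_nat.
  have : 4 <= rho^-1 ^+ j.
    apply: le_trans (bern j); rewrite ltr_pdivrMr // in hb; lra.
  rewrite exprVn -[4 in X in X -> _]invrK lef_pV2 ?posrE ?exprn_gt0 //; lra.
(* The 3 accounts for the factor 8 of [balanced_dense]. *)
exists a, (kap + 3)%N; split => //; first by rewrite addn3.
move=> eps eps0.
exists (2 + Num.bound (4 / eps))%N => n nN E hE.
have n2 : (2 <= n)%N by apply: leq_trans nN; rewrite leq_addr.
have n0 : 0 < n%:R :> R by rewrite ltr0n; apply: leq_trans n2.
set l := trunc_log 2 n in hE *.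
have hy : n%:R ^+ 2 * rho ^+ (a * l.+1) <= 1.
  rewrite exprM; apply: (@le_trans _ _ (n%:R ^+ 2 * (1 / 4) ^+ l.+1)).
    apply: ler_wpM2l; first by rewrite exprn_ge0 // ltW.
    apply: lerXn2r; rewrite ?nnegrE //.
    by apply: exprn_ge0; apply: ltW.
  rewrite div1r exprVn ler_pdivrMr ?exprn_gt0 ?mul1r //.
  have -> : 4 = 2 ^+ 2 :> R by rewrite expr2; lra.
  rewrite -exprM mulnC exprM; apply: lerXn2r; rewrite ?nnegrE ?exprn_ge0 //.
  by rewrite -natrX ler_nat ltnW // trunc_log_ltn.
have hn2 : 2 <= n%:R :> R by rewrite ler_nat.
have y0 : 0 < rho ^+ (a * l.+1) by rewrite exprn_gt0.
have hb : 4 / eps < n%:R.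
  apply: lt_le_trans (archi_boundP _) _; first by apply: divr_ge0 => //; apply: ltW.
  by rewrite ler_nat (leq_trans _ nN) // leq_addl.
have hny : n%:R * (n%:R * rho ^+ (a * l.+1)) <= 1 by rewrite mulrA -expr2.
apply: le_trans (le_Gnp_prob p01 (E := balanced k (2 * (a * l.+1)).+1) _).
  apply: le_trans (Gnp_prob_balanced p01 k0 th1 th2 (ltW hkap) _).
    rewrite lerD2l lerN2 -/rho; rewrite ltr_pdivrMr // in hb.
    move: hny; rewrite -[4 * _ * _]mulrA; set t := n%:R * rho ^+ _ => hny.
    have t0 : 0 <= t by apply: mulr_ge0; apply: ltW.
    rewrite -(ler_pM2l n0); nra.
  rewrite -/rho -mulrA; set t := n%:R * rho ^+ (a * l.+1)%N in hny *.
  have t0 : 0 <= t by apply: mulr_ge0; apply: ltW.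
  nra.
move=> G GP /balanced_dense []; first by rewrite ltnS muln_gt0 muln_gt0 a0.
have -> : (8 * k = 2 ^ (kap + 3))%N by rewrite expnD mulnC.
exact: hE.
Qed.

(** * The two bounds *)

(** Split [2 ^ l./2] into two factors of exponent about [l / 4]: one exceeds [4 * C], the other
    takes care of [l.+1]. *)
Lemma linear_le_exp (C : nat) : exists l0 : nat, forall l : nat, (l0 <= l)%N ->
  (C * l.+1 <= 2 ^ l./2)%N.
Proof.
exists (16 * C + 8)%N => l hl.
have h1 : (4 * C <= l./2./2)%N by lia.
have e : (2 ^ l./2 = 2 ^ (l./2./2) * 2 ^ (l./2 - l./2./2))%N.
  by rewrite -expnD subnKC //; lia.
rewrite e; have := ltn_expl (l./2./2) (isT : 1 < 2)%N.
have := ltn_expl (l./2 - l./2./2) (isT : 1 < 2)%N.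
set X := (2 ^ _)%N; set Y := (2 ^ _)%N => hX hY.
apply: (@leq_trans (4 * C * (l./2 - l./2./2).+1)%N).
  by rewrite -mulnA mulnCA leq_mul2l; apply/orP; right; lia.
by apply: leq_mul => //; lia.
Qed.

(** Choice of parameters for [ex_ind_lower], with [q = 2 ^ k] and [M = q ^ s]. Rounding
    [n / (2 * L)] down to a power of [2 ^ s] loses a factor of at most [2 ^ s]. *)
Lemma ex_ind_lower_nat (s r b a n : nat) (Gam : {set {set 'I_n}}) :
  let l := trunc_log 2 n in
  (0 < s)%N -> (0 < b)%N -> (degree_bound s ^ s + s < r)%N -> Gam \subset pairs n ->
  (2 * b <= l)%N -> (2 ^ (b + s + 3) * (2 * a + 1) * l.+1 <= 2 ^ l./2)%N ->
  dense_rel (2 * (a * l.+1)).+1 (2 ^ b) (adj Gam) ->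
  exists M L q : nat, [/\ (0 < q)%N, (q ^ s)%N = M, (n <= 2 ^ s.+1 * (M * L))%N,
     (l <= 4 * b * L)%N & ((M * L) ^ 2 <= 4 * 2 ^ b * q * ex_ind_Ksr s r Gam)%N].
Proof.
move=> l s0 b0 hr GamP hl big dns.
have n0 : (0 < n)%N by case: n @l Gam GamP hl big dns; rewrite ?trunc_log0 //; lia.
(* Chosen so that [(2 ^ b) ^ L <= 2 ^ l./2], which is at most about the square root of [n]. *)
pose L := (l %/ (2 * b))%N.
have L0 : (0 < L)%N by rewrite divn_gt0 // muln_gt0.
have lL : (l <= 4 * b * L)%N.
  have := divn_eq l (2 * b); rewrite -/L.
  have : (l %% (2 * b) < 2 * b)%N by rewrite ltn_mod muln_gt0.
  have : (2 * b <= L * (2 * b))%N by rewrite leq_pmull.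
  by lia.
have Ll : (L <= l)%N by apply: leq_div.
have ln : (2 ^ l <= n)%N by apply: trunc_logP.
set m := (2 * _).+1 in dns.
have m_le : (m <= (2 * a + 1) * l.+1)%N by rewrite /m; nia.
have half_le : (2 ^ l./2 * 2 ^ l./2 <= n)%N.
  by apply: leq_trans ln; rewrite -expnD leq_exp2l //; lia.
have half0 : (0 < 2 ^ l./2)%N by rewrite expn_gt0.
have bigX : (2 ^ (b + s + 3) * ((2 * a + 1) * l.+1) <= n)%N.
  by rewrite mulnA; apply: leq_trans big _; apply: leq_trans half_le; rewrite leq_pmulr.
have l_le : (l.+1 <= (2 * a + 1) * l.+1)%N by rewrite leq_pmull // addn1.
set u := trunc_log 2 (n %/ (2 * L)).
have hu : (2 ^ u * (2 * L) <= n)%N.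
  rewrite -leq_divRL ?muln_gt0 //; apply: trunc_logP => //.
  rewrite divn_gt0 ?muln_gt0 //; apply: leq_trans bigX.
  apply: leq_mul; last by apply: leq_trans l_le; apply: leq_trans Ll _.
  by rewrite -[2%N]expn1 leq_exp2l //; lia.
have hu2 : (n < 2 ^ u.+1 * (2 * L))%N.
  by rewrite -ltn_divLR ?muln_gt0 // trunc_log_ltn.
(* The margin [s] leaves [b <= k * s] after rounding [u] down to a multiple of [s]; this is the
   condition [d <= M]. *)
have bsu : (b + s <= u)%N.
  rewrite -ltnS -(ltn_exp2l _ _ (isT : 1 < 2)%N).
  rewrite -(ltn_pmul2r (_ : 0 < 2 * L)%N) ?muln_gt0 //.
  apply: leq_ltn_trans hu2; apply: leq_trans bigX.
  have -> : (2 ^ (b + s + 3) = 2 ^ (b + s) * 8)%N by rewrite expnD.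
  rewrite -!mulnA leq_mul2l; apply/orP; right; lia.
pose k := (u %/ s)%N.
have uk : (u = k * s + u %% s)%N by apply: divn_eq.
have us : (u %% s < s)%N by rewrite ltn_mod.
have bks : (b <= k * s)%N by lia.
have k0 : (0 < k)%N by case: (k) bks => //; lia.
have [chi [chiC hchi]] := norm_coloring s0 k0.
pose M := (2 ^ (k * s))%N.
have ML : (2 * (M * L) <= n)%N.
  apply: leq_trans hu; rewrite mulnCA leq_mul2r; apply/orP; right.
  by rewrite leq_exp2l // uk leq_addr.
have nML : (n <= 2 ^ s.+1 * (M * L))%N.
  apply: leq_trans (ltnW hu2) _.
  have -> : (2 ^ s.+1 * (M * L) = 2 ^ (s + k * s) * (2 * L))%N.
    by rewrite expnD expnS /M; ring.
  by rewrite leq_mul2r leq_exp2l //; apply/orP; right; lia.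
exists M, L, (2 ^ k)%N; split => //; first by rewrite expn_gt0.
  by rewrite -expnM.
apply: (@ex_ind_lower n Gam m (2 ^ b) L M (2 ^ k) s r (degree_bound s ^ s) chi) => //.
- by rewrite expn_gt0.
- have dL : ((2 ^ b) ^ L <= 2 ^ l./2)%N.
    rewrite -expnM leq_exp2l //.
    have : (L * (2 * b) <= l)%N by apply: leq_trunc_div.
    by lia.
  apply: leq_trans half_le; rewrite mulnA; apply: leq_mul => //.
  apply: leq_trans big; rewrite -mulnA; apply: leq_mul => //.
  by rewrite -[2%N in leqLHS]expn1 leq_exp2l //; lia.
- by rewrite expn_gt0.
- by rewrite leq_exp2l.
- rewrite -(leq_pmul2l (_ : 0 < 2 ^ s.+1)%N) ?expn_gt0 //.
  apply: leq_trans nML; apply: leq_trans bigX; apply: leq_mul => //.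
  by rewrite leq_exp2l //; lia.
Qed.

(** * Logarithms and the real form of the bounds *)

Section Logs.
Variable R : realType.

Lemma half_le_ln2 : 1 / 2 <= ln (2 : R).
Proof.
rewrite -ler_expR lnK ?posrE //.
have h : 1 + - (1 / 2) <= expR (- (1 / 2)) :> R by apply: expR_ge1Dx.
rewrite expRN in h.
have e0 : 0 < expR (1 / 2 : R) by apply: expR_gt0.
rewrite -[leRHS]invrK -[leLHS]invrK lef_pV2 ?posrE ?invr_gt0 //; lra.
Qed.

Lemma ln2_le1 : ln (2 : R) <= 1.
Proof.
rewrite -ler_expR lnK ?posrE //.
by apply: le_trans (expR_ge1Dx _); lra.
Qed.

Lemma trunc_log_ln n : (0 < n)%N ->
  (trunc_log 2 n)%:R / 2 <= ln (n%:R : R) <= (trunc_log 2 n).+1%:R.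
Proof.
move=> n0; set l := trunc_log 2 n.
have h1 : (2 ^ l <= n)%N by apply: trunc_logP.
have h2 : (n < 2 ^ l.+1)%N by apply: trunc_log_ltn.
have lnpow j : ln ((2 ^ j)%:R : R) = j%:R * ln 2.
  by rewrite natrX lnXn // mulr_natl.
apply/andP; split.
  apply: (@le_trans _ _ (ln ((2 ^ l)%:R : R))).
    by rewrite lnpow ler_wpM2l //; have := half_le_ln2; lra.
  by rewrite ler_ln ?posrE ?ltr0n ?expn_gt0 // ler_nat.
apply: (@le_trans _ _ (ln ((2 ^ l.+1)%:R : R))).
  by rewrite ler_ln ?posrE ?ltr0n ?expn_gt0 // ler_nat ltnW.
by rewrite lnpow ler_piMr // ln2_le1.
Qed.

(** Isolates [y], the rate divided by [n], through its [s]-th power, so that later estimates use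
    integer exponents only. *)
Lemma rate_factor (s n : nat) : (0 < s)%N -> (1 < n)%N ->
  exists y : R, [/\ 0 < y, y ^+ s = n%:R ^+ s.-1 * ln n%:R &
    n%:R `^ (2 - s%:R^-1) * ln n%:R `^ s%:R^-1 = n%:R * y].
Proof.
move=> s0 n1; exists (n%:R `^ (1 - s%:R^-1) * ln n%:R `^ s%:R^-1).
have n0 : 0 < n%:R :> R by rewrite ltr0n ltnW.
have l0 : 0 < ln (n%:R : R) by apply: ln_gt0; rewrite ltr1n.
have sn0 : s%:R != 0 :> R by rewrite pnatr_eq0 lt0n_neq0.
split.
- by rewrite mulr_gt0 // powR_gt0.
- rewrite exprMn -!powR_mulrn ?powR_ge0 // -!powRrM mulVf // powRr1 ?ltW //.
  congr (_ * _); rewrite mulrBl mul1r mulVf //; congr (_ `^ _).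
  by rewrite -[in LHS](prednK s0) -natr1 addrK.
- rewrite mulrA; congr (_ * _); rewrite -[X in _ = X * _]powRr1 ?ltW //.
  by rewrite -powRD ?(gt_eqF n0) ?implybT //; congr (_ `^ _); lra.
Qed.

End Logs.

(** Degrees up to [y] sum to at most [n * y]. A larger degree is at most [deg ^ s / y ^ (s - 1)],
    and [m * d ^ s <= y] brings it within reach of [degree_power_sum]. *)
Lemma ex_ind_upper (R : realType) (s r m d n : nat) (Gam : {set {set 'I_n}})
    (y K : R) : (0 < s)%N -> (0 < m)%N -> (0 < d)%N -> Gam \subset pairs n ->
  dense_rel m d (nonadj Gam) -> 0 < y -> y ^+ s = n%:R ^+ s.-1 * ln n%:R ->
  m%:R <= K * ln n%:R -> (m * d ^ s)%:R <= y ->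
  (ex_ind_Ksr s r Gam)%:R <= (1 + K * (d ^ (s ^ 2 + r))%:R) * (n%:R * y).
Proof.
move=> s0 m0 d0 GamP dns y0 ys mK my.
set X := (X in _ <= X).
have X0 (G : {set {set 'I_n}}) : G \subset Gam -> ~~ has_induced_Ksr s r G -> #|G|%:R <= X.
  move=> GGam free.
  have GP := subset_trans GGam GamP.
  have ys0 : 0 < y ^+ s.-1 by apply: exprn_gt0.
  have sE : y ^+ s = y ^+ s.-1 * y by rewrite -exprSr prednK.
  have hdeg v : #|nbrs G v|%:R <= y + (if (m * d ^ s <= #|nbrs G v|)%N
      then #|nbrs G v|%:R ^+ s / y ^+ s.-1 else 0).
    have [le_y|lt_y] := leP (#|nbrs G v|%:R : R) y.
      apply: le_trans le_y _; rewrite lerDl; case: ifP => // _.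
      by rewrite divr_ge0 ?exprn_ge0 // ltW.
    have -> : (m * d ^ s <= #|nbrs G v|)%N by rewrite -(ler_nat R) (le_trans my) // ltW.
    apply: (@le_trans _ _ (#|nbrs G v|%:R ^+ s / y ^+ s.-1)); last by rewrite lerDr ltW.
    rewrite ler_pdivlMr // -[in leRHS](prednK s0) exprS ler_wpM2l //.
    by apply: lerXn2r; rewrite ?nnegrE // ltW.
  apply: (@le_trans _ _ (\sum_v (#|nbrs G v|%:R : R))).
    by rewrite -natr_sum ler_nat card_le_degree_sum.
  apply: le_trans (ler_sum _ (fun v _ => hdeg v)) _.
  rewrite big_split /= sumr_const card_ord -big_mkcond /= -mulr_suml -mulr_natl.
  have hP := degree_power_sum GamP GGam m0 d0 dns free.
  have hS : \sum_(v | (m * d ^ s <= #|nbrs G v|)%N) (#|nbrs G v|%:R ^+ s : R)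
     <= (d ^ (s ^ 2 + r))%:R * K * (n%:R * y ^+ s).
    apply: (@le_trans _ _ ((d ^ (s ^ 2) * (n ^ s * (m * d ^ r)))%:R)).
      rewrite (eq_bigr (fun v => (#|nbrs G v| ^ s)%:R)) => [|v _]; last by rewrite natrX.
      by rewrite -natr_sum ler_nat.
    have -> : (d ^ (s ^ 2) * (n ^ s * (m * d ^ r)) = d ^ (s ^ 2 + r) * n ^ s * m)%N.
      by rewrite expnD; ring.
    rewrite natrM natrM (natrX _ n) ys -[in n%:R ^+ s](prednK s0) exprS.
    have -> : (d ^ (s ^ 2 + r))%:R * K * (n%:R * (n%:R ^+ s.-1 * ln n%:R)) =
      (d ^ (s ^ 2 + r))%:R * (n%:R * n%:R ^+ s.-1) * (K * ln n%:R) :> R by ring.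
    by apply: ler_wpM2l mK; rewrite !mulr_ge0 // exprn_ge0.
  rewrite /X mulrDl mul1r lerD2l ler_pdivrMr //.
  apply: le_trans hS _; rewrite sE le_eqVlt; apply/orP; left; apply/eqP; ring.
apply: (big_ind (fun k : nat => k%:R <= X)) => [|i j hi hj|G /andP[]].
- rewrite /X mulr_ge0 ?mulr_ge0 ?(ltW y0) // addr_ge0 // mulr_ge0 //.
  have ln0 : 0 < ln (n%:R : R).
    have : 0 < n%:R ^+ s.-1 * ln (n%:R : R) by rewrite -ys exprn_gt0.
    have : 0 <= n%:R ^+ s.-1 :> R by rewrite exprn_ge0.
    by move=> p1 p2; rewrite ltNge; apply/negP => p3; nra.
  by rewrite -(pmulr_lge0 _ ln0); apply: le_trans mK.
- by rewrite /maxn; case: ifP.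
- exact: X0.
Qed.

(** With [A = M * L], the quotient [z = A / q] satisfies [z ^ s = A ^ (s - 1) * L], the shape of the
    equation for [y]. Hence [y] is at most a constant times [z], while [A * z = A ^ 2 / q] is
    bounded by the extremal number. *)
Lemma ex_ind_lower_real (R : realType) (s b n M L q ex : nat) (y : R) :
  (0 < s)%N -> (0 < b)%N -> (0 < n)%N -> 0 < y ->
  y ^+ s = n%:R ^+ s.-1 * ln n%:R ->
  (0 < q)%N -> (q ^ s)%N = M -> (n <= 2 ^ s.+1 * (M * L))%N ->
  ln n%:R <= (8 * b * L)%:R :> R -> ((M * L) ^ 2 <= 4 * 2 ^ b * q * ex)%N ->
  ((2 ^ s.+1 * (8 * b))%:R * (2 ^ s.+1 * (4 * 2 ^ b))%:R)^-1 * (n%:R * y) <= ex%:R.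
Proof.
move=> s0 b0 n0 y0 ys q0 qM nA lnL hex.
set A := (M * L)%N in nA hex.
have A0 : (0 < A)%N by rewrite lt0n; apply: contraTneq nA => ->; rewrite muln0 -ltnNge.
have qR : 0 < q%:R :> R by rewrite ltr0n.
pose z : R := A%:R / q%:R.
have z0 : 0 <= z by rewrite divr_ge0.
have zs : z ^+ s = A%:R ^+ s.-1 * L%:R.
  have M0 : M%:R != 0 :> R.
    by rewrite pnatr_eq0; move: A0; rewrite /A muln_gt0 lt0n => /andP[].
  rewrite exprMn exprVn -(natrX _ q) qM -[in LHS](prednK s0) exprSr /A natrM.
  by rewrite -!mulrA; congr (_ * _); rewrite mulrCA mulfV ?mulr1.
set ka := (2 ^ s.+1 * (8 * b))%N; set P := (2 ^ s.+1)%N.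
have P0 : (0 < P)%N by rewrite expn_gt0.
have ka0 : 0 < ka%:R :> R by rewrite ltr0n !muln_gt0 expn_gt0 b0.
have ln_ge0 : 0 <= ln (n%:R : R) by rewrite ln_ge0 // ler1n.
have yz : y <= ka%:R * z.
  rewrite -(@ler_pXn2r _ s) ?nnegrE ?(ltW y0) ?mulr_ge0 ?(ltW ka0) //.
  rewrite exprMn ys zs.
  apply: (@le_trans _ _ ((P%:R * A%:R) ^+ s.-1 * (8 * b * L)%:R)).
    apply: ler_pM => //.
    by apply: lerXn2r; rewrite ?nnegrE ?mulr_ge0 // -natrM ler_nat.
  rewrite exprMn -[in ka%:R ^+ s](prednK s0) exprSr natrM.
  have -> : P%:R ^+ s.-1 * A%:R ^+ s.-1 * ((8 * b)%:R * L%:R) =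
    (P%:R ^+ s.-1 * (8 * b)%:R) * (A%:R ^+ s.-1 * L%:R) :> R by ring.
  apply: ler_wpM2r; first by rewrite mulr_ge0 ?exprn_ge0.
  apply: ler_pM; rewrite ?exprn_ge0 //.
    by apply: lerXn2r; rewrite ?nnegrE // ler_nat /ka leq_pmulr // muln_gt0 b0.
  by rewrite ler_nat /ka leq_pmull // expn_gt0.
have hz : A%:R * z <= (4 * 2 ^ b)%:R * ex%:R.
  rewrite /z mulrA ler_pdivrMr // -!natrM ler_nat -mulnn in hex *.
  by rewrite mulnAC.
rewrite invfM -mulrA ler_pdivrMl // ler_pdivrMl ?ltr0n ?muln_gt0 ?expn_gt0 //.
apply: (@le_trans _ _ ((P%:R * A%:R) * (ka%:R * z))).
  by apply: ler_pM; rewrite ?(ltW y0) // -natrM ler_nat.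
have -> : P%:R * A%:R * (ka%:R * z) = P%:R * ka%:R * (A%:R * z) by ring.
apply: le_trans (ler_wpM2l _ hz) _; first by rewrite mulr_ge0.
by rewrite le_eqVlt; apply/orP; left; apply/eqP; rewrite (natrM _ P); ring.
Qed.

Theorem theorem1p5 (R : realType) :
  forall s : nat, (2 <= s)%N ->
  exists r0 : nat, forall r : nat, (s <= r)%N -> (r0 <= r)%N ->
  forall p : R, 0 < p < 1 ->
  exists c C : R, 0 < c /\ 0 < C /\
  forall eps : R, 0 < eps ->
  exists N : nat, forall n : nat, (N <= n)%N ->
    1 - eps <= @Gnp_prob R n p (fun Gam =>
      let f := (n%:R) `^ (2 - s%:R^-1) * (ln (n%:R)) `^ (s%:R^-1) in
      (c * f <= (ex_ind_Ksr s r Gam)%:R) && ((ex_ind_Ksr s r Gam)%:R <= C * f)).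
Proof.
move=> s s2; have s0 : (0 < s)%N by apply: leq_trans s2.
(* The place where [2 <= s] matters: it lets [K' ^ s] be absorbed by [(K' ^ 2) ^ (s - 1)]. *)
have ss : (s <= 2 * s.-1)%N by lia.
exists (degree_bound s ^ s + s).+1 => r _ hr p p01.
have [a [b [a0 b0 hprob]]] := Gnp_dense p01.
(* From [l <= 2 * ln n] and [ln n >= 1 / 2], the threshold [2 * a * l.+1 + 1] is at most
   [K * ln n]. *)
pose K : R := (8 * a + 2)%:R.
exists ((2 ^ s.+1 * (8 * b))%:R * (2 ^ s.+1 * (4 * 2 ^ b))%:R)^-1.
exists (1 + K * ((2 ^ b) ^ (s ^ 2 + r))%:R).
split.
  by rewrite invr_gt0 mulr_gt0 // ltr0n !muln_gt0 !expn_gt0 ?b0.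
split; first by rewrite ltr_wpDr // mulr_ge0.
move=> eps eps0.
have [N1 hN1] := hprob eps eps0.
pose K' := ((8 * a + 2) * (2 ^ b) ^ s)%N.
have [l0 hl0] := linear_le_exp (2 * b + 2 ^ (b + s + 3) * (2 * a + 1) + K' ^ 2)%N.
exists (N1 + 2 ^ (l0 + 2 * b + 1))%N => n hn.
have nN1 : (N1 <= n)%N by apply: leq_trans hn; rewrite leq_addr.
have n2l : (2 ^ (l0 + 2 * b + 1) <= n)%N by apply: leq_trans hn; rewrite leq_addl.
have n2 : (1 < n)%N.
  by apply: leq_trans n2l; rewrite addn1 expnS leq_pmulr // expn_gt0.
have n0 : (0 < n)%N := ltnW n2.
set l := trunc_log 2 n.
have hl : (l0 + 2 * b + 1 <= l)%N by apply: trunc_log_max.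
have hbig : ((2 * b + 2 ^ (b + s + 3) * (2 * a + 1) + K' ^ 2) * l.+1 <= 2 ^ l./2)%N.
  by apply: hl0; lia.
have ln2l : (2 ^ l <= n)%N by apply: trunc_logP.
have [y [y0 ys fE]] := rate_factor R s0 n2.
have /andP[ln_lb ln_ub] := trunc_log_ln R n0; rewrite -/l in ln_lb ln_ub.
have ln1 : 1 / 2 <= ln (n%:R : R).
  apply: le_trans ln_lb; have : 1 <= l%:R :> R by rewrite ler1n; lia.
  by lra.
apply: hN1 => // Gam GamP dadj dnon; rewrite fE; apply/andP; split.
  have hlb : (2 * b <= l)%N.
    by apply: leq_trans hl; rewrite addn1 leqW // leq_addl.
  have hlbig : (2 ^ (b + s + 3) * (2 * a + 1) * l.+1 <= 2 ^ l./2)%N.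
    apply: leq_trans hbig; rewrite leq_mul2r; apply/orP; right.
    exact: leq_trans (leq_addl _ _) (leq_addr _ _).
  have [M [L [q [q0 qM nML lL hex]]]] := ex_ind_lower_nat s0 b0 hr GamP hlb hlbig dadj.
  apply: (ex_ind_lower_real s0 b0 n0 y0 ys q0 qM nML _ hex).
  apply: le_trans ln_ub _; rewrite ler_nat -/l; rewrite -/l in lL.
  by clear -lL l hl; nia.
have mK : (2 * (a * l.+1)).+1%:R <= K * ln n%:R.
  rewrite /K -natr1 !natrM natrD natrM -natr1.
  have : 0 <= a%:R :> R by [].
  nra.
apply: (ex_ind_upper r s0 _ _ GamP dnon y0 ys mK) => //.
  by rewrite expn_gt0.
have K'1 : 1 <= K'%:R :> R.
  by rewrite ler1n muln_gt0 expn_gt0 expn_gt0 addn_gt0 orbT.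
have lnn : K'%:R ^+ 2 * ln n%:R <= n%:R :> R.
  apply: (@le_trans _ _ ((K' ^ 2 * l.+1)%:R)).
    by rewrite natrM natrX ler_wpM2l ?exprn_ge0.
  rewrite ler_nat; apply: leq_trans ln2l.
  apply: leq_trans (leq_trans hbig _); last by rewrite leq_exp2l // -divn2 leq_div.
  by rewrite leq_mul2r leq_addl orbT.
apply: (@le_trans _ _ (K'%:R * ln n%:R)).
  rewrite natrM /K' natrM mulrAC; apply: ler_wpM2r => //.
have ln0 : 0 <= ln (n%:R : R) by lra.
(* After taking [s]-th powers and cancelling one [ln n], what remains follows from [lnn] raised to
   the power [s - 1]. *)
rewrite -(ler_pXn2r s0) ?nnegrE ?(ltW y0) ?mulr_ge0 //.
rewrite ys exprMn -[in X in _ * X](prednK s0) exprSr mulrA; apply: ler_wpM2r => //.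
apply: (@le_trans _ _ ((K'%:R ^+ 2 * ln n%:R) ^+ s.-1)).
  rewrite exprMn; apply: ler_wpM2r; first by apply: exprn_ge0.
  by rewrite -exprM; apply: ler_weXn2l.
by apply: lerXn2r; rewrite ?nnegrE ?mulr_ge0 ?exprn_ge0.
Qed.
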